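(* Let $e_{ij}\in E$ be an edge of the Voronoi graph $(V,E)$ described in the context, parametrized by $x(t)=(1-t)v_i+tv_j$ for $t\in[0,1]$, and let $y^{(1)},\ldots,y^{(n)}:[0,1]\to\mathbb{C}$ be the $n$ continuous branches of solutions of $f(x(t),y)=0$ along this edge. Then one can algorithmically determine a subdivision $$0=t_0<t_1<t_2<\cdots<t_{m_{ij}}=1$$ and real numbers $\epsilon_0,\ldots,\epsilon_{m_{ij}-1}$ such that for all $m\in\{0,\ldots,m_{ij}-1\}$, all $t$ with $t_m\leq t\leq t_{m+1}$ and all $k,k'\in\{1,\ldots,n\}$, we have $$|y^{(k')}(t)-y^{(k)}(t_m)|<\epsilon_m\quad\text{if and only if}\quad k'=k.$$
   Context: Let $K\subset\mathbb{C}$ be a field finitely generated over $\mathbb{Q}$ and let $f(x,y)=f_n(x)y^n+\cdots+f_0(x)\in K[x,y]$ with $f_n\neq 0$ be a polynomial such that $f(x,y)=0$ is a (possibly singular) affine plane model of a nonsingular, complete, absolutely irreducible algebraic curve $C$ over $K$. The finite critical locus is $S=\{x\in\mathbb{C}:\operatorname{disc}_y(f)(x)=0\}$. Voronoi graph. Let $c_0=\frac{1}{\#S}\sum_{s\in S}s$, let $s_1',\ldots,s_6'$ be the vertices of a regular hexagon inscribed in the circle with centre $c_0$ and radius $2\max_{s\in S}|s-c_0|$ (assumed positive), and put $S'=S\cup\{s_1',\ldots,s_6'\}$. The Voronoi cells are $F_s=\{x\in\mathbb{C}:|x-s|\leq|x-s'|\text{ for all }s'\in S'-\{s\}\}$ for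 $s\in S'$. Let $V=\{v_1,\ldots,v_r\}\subset\mathbb{C}$ be the set of vertices of this Voronoi decomposition and $E$ the set of its bounded edges, which are line segments $e_{ij}$ between $v_i,v_j\in V$. The edges avoid the critical locus $S$. Branches. It is a standing assumption that for every point $x_0$ on the edge $e_{ij}$ the equation $f(x_0,y)=0$ has exactly $n$ distinct simple roots in $\mathbb{C}$ (in particular $f_n(x_0)\neq0$). Consequently, labelling the roots of $f(v_i,y)=0$ as $y(v_i^{(1)}),\ldots,y(v_i^{(n)})$, there are unique continuous functions $y^{(k)}:[0,1]\to\mathbb{C}$ with $f(x(t),y^{(k)}(t))=0$ and $y^{(k)}(0)=y(v_i^{(k)})$, for $k=1,\ldots,n$. *)

(* Defs.v *)
From HB Require Import structures.
From mathcomp Require Import all_boot all_order all_algebra finmap polyXY.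
From mathcomp Require Import complex.
From mathcomp Require Import all_classical reals topology normedtype.
From Stdlib Require Cantor.

Set Implicit Arguments.
Unset Strict Implicit.
Unset Printing Implicit Defensive.

Import Order.TTheory GRing.Theory Num.Theory.
Import numFieldNormedType.Exports.
Local Open Scope classical_set_scope.
Local Open Scope ring_scope.

(* R-valued modulus of a complex number; the library's `|z| lives in R[i]. *)
Notation cmod := ComplexField.Normc.normc.

(* "One can algorithmically determine" is expressed with Kleene's partial
  recursive functions relative to an oracle o : nat -> nat.  Functions are
  unary; several arguments are packed with Cantor's pairing.  The oracle is
  the only access a program has to the (complex) data of the problem. *)

Definition npair (x y : nat) : nat := Cantor.to_nat (x, y).

Inductive code : Type :=
| Zero
| Succ
| Fst
| Snd
| Oracle
| Pair of code & code
| Comp of code & code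
| Prec of code & code
| Mu of code.

(* eval o c a b : on input a and with oracle o, the program c halts with
   result b. *)
Inductive eval (o : nat -> nat) : code -> nat -> nat -> Prop :=
| eval_zero a : eval o Zero a 0
| eval_succ a : eval o Succ a a.+1
| eval_fst a : eval o Fst a (Cantor.of_nat a).1
| eval_snd a : eval o Snd a (Cantor.of_nat a).2
| eval_oracle a : eval o Oracle a (o a)
| eval_pair c d a x y :
    eval o c a x -> eval o d a y -> eval o (Pair c d) a (npair x y)
| eval_comp c d a x y :
    eval o d a x -> eval o c x y -> eval o (Comp c d) a y
| eval_prec0 c d a x :
    eval o c a x -> eval o (Prec c d) (npair a 0%N) x
| eval_precS c d a n x y :
    eval o (Prec c d) (npair a n) x ->
    eval o d (npair a (npair n x)) y ->
    eval o (Prec c d) (npair a n.+1) y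
| eval_mu c a n (r : nat -> nat) :
    (forall m, (m < n)%N -> eval o c (npair a m) (r m).+1) ->
    eval o c (npair a n) 0 ->
    eval o (Mu c) a n.

Lemma npair_inj x y x' y' : npair x y = npair x' y' -> x = x' /\ y = y'.
Proof. by move=> /Cantor.to_nat_inj[]. Qed.

Lemma eval_inv o c a y : eval o c a y ->
  match c with
  | Zero => y = 0%N
  | Succ => y = a.+1
  | Fst => y = (Cantor.of_nat a).1
  | Snd => y = (Cantor.of_nat a).2
  | Oracle => y = o a
  | Pair c d =>
      exists x x', [/\ eval o c a x, eval o d a x' & y = npair x x']
  | Comp c d => exists2 x, eval o d a x & eval o c x y
  | Prec c d =>
      (exists2 b, a = npair b 0 & eval o c b y) \/
      (exists b n x, [/\ a = npair b n.+1, eval o (Prec c d) (npair b n) x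
                       & eval o d (npair b (npair n x)) y])
  | Mu c => eval o c (npair a y) 0 /\
      forall m, (m < y)%N -> exists r, eval o c (npair a m) r.+1
  end.
Proof.
case=> {c a y} //.
- by move=> c d a x x' *; exists x, x'.
- by move=> c d a x y *; exists x.
- by move=> c d a x ?; left; exists a.
- by move=> c d a n x y *; right; exists a, n, x.
- by move=> c a n r Hr ?; split=> // m /Hr; exists (r m).
Qed.

Lemma eval_det o c a x y : eval o c a x -> eval o c a y -> x = y.
Proof.
move=> H; elim: H y => {c a x}.
1-5: by move=> a y /eval_inv ->.
- move=> c d a x x' _ IH _ IH' y /eval_inv[z [z' [/IH -> /IH' -> ->]]] //.
- by move=> c d a x x' _ IH _ IH' y /eval_inv[z /IH <- /IH'].
- move=> c d a x _ IH y /eval_inv[[b /npair_inj[<- _] /IH] //|].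
  by move=> [b [n [z [/npair_inj[]]]]].
- move=> c d a n x x' _ IH _ IH' y /eval_inv[[b /npair_inj[]] //|].
  by move=> [b [m [z [/npair_inj[<- [<-]] /IH <- /IH']]]].
- move=> c a n r _ IH _ IH' y /eval_inv[H0 Hlt].
  case: (ltngtP n y) => // [/Hlt[k /IH'] //|yn].
  by have := IH _ yn _ H0.
Qed.

(* The code npair (npair p q) b represents the rational (p - q) / (b + 1). *)
Definition rat_of_code (c : nat) : rat :=
  let: (a, b) := Cantor.of_nat c in
  let: (p, q) := Cantor.of_nat a in
  (p%:Z - q%:Z)%:~R / b.+1%:R.

Definition seq_code (s : seq nat) : nat :=
  foldr (fun x c => (npair x c).+1) 0%N s.

Lemma seq_code_inj : injective seq_code.
Proof.
elim=> [|x s IH] [|y t] //= /succn_inj E.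
by case: (npair_inj E) => -> /IH ->.
Qed.

(* With oracle o and input a, the program c outputs the two finite lists of
   rational numbers ts and es. *)
Definition outputs (o : nat -> nat) (c : code) (a : nat) (ts es : seq rat) :=
  exists us ds : seq nat,
    [/\ eval o c a (npair (seq_code us) (seq_code ds)),
        ts = map rat_of_code us & es = map rat_of_code ds].

Definition subdivision01 (ts : seq rat) :=
  [/\ head 1 ts = 0, last 0 ts = 1 & sorted <%R ts].

Section Complex.
Variable R : realType.
Local Notation C := (R[i]).

(* The oracle o is a name of the family z of complex numbers: queried at
   (k, p) it returns a Gaussian rational at distance at most 2^-p from z k. *)
Definition names (o : nat -> nat) (z : nat -> C) :=
  forall k p : nat,
    let: (a, b) := Cantor.of_nat (o (npair k p)) in
    cmod (Complex (ratr (rat_of_code a)) (ratr (rat_of_code b)) - z k)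
      <= 2 ^- p.

(* The bivariate polynomial f = sum_j f_j(x) y^j is an f : {poly {poly C}}
  whose outer variable is y: f`_j is f_j, and f`_j`_i is the coefficient of
  x^i y^j. *)

Definition finitely_generated (K : divringClosed C) :=
  exists2 gens : seq C, {subset gens <= K} &
    forall L : divringClosed C, {subset gens <= L} -> {subset K <= L}.

Definition algebraic_over (K : divringClosed C) (z : C) :=
  exists2 p : {poly C}, p != 0 & p \is a polyOver K /\ root p z.

Definition bi_constant (f : {poly {poly C}}) := exists c : C, f = c%:P%:P.

Definition absolutely_irreducible (K : divringClosed C)
    (f : {poly {poly C}}) :=
  ~ bi_constant f /\
  forall g h : {poly {poly C}},
    (forall i j, algebraic_over K g`_j`_i) ->
    (forall i j, algebraic_over K h`_j`_i) ->
    f = g * h -> bi_constant g \/ bi_constant h.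

(* The one-variable polynomial f(x0, y) in y. *)
Definition fiber (f : {poly {poly C}}) (x0 : C) : {poly C} :=
  map_poly (horner_eval x0) f.

(* disc_y f = (-1)^(n(n-1)/2) Res_y(f, df/dy) / f_n; the division is exact. *)
Definition disc_y (f : {poly {poly C}}) : {poly C} :=
  (-1) ^+ 'C((size f).-1, 2) * (resultant f f^`() %/ lead_coef f).

Definition critical_locus (f : {poly {poly C}}) : set C :=
  [set x | root (disc_y f) x].

(* For a finite set S. *)
Definition barycenter (S : set C) : C :=
  (\sum_(s <- fset_set S) s) / (#|` fset_set S|)%fset%:R.

Definition max_distance (S : set C) (c : C) : R :=
  \big[Order.max/0]_(s <- fset_set S) cmod (s - c).

(* h lists the vertices, in cyclic order, of a regular hexagon inscribed in
   the circle with centre c and radius r. *)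
Definition regular_hexagon (c : C) (r : R) (h : 'I_6 -> C) :=
  exists u z : C, [/\ cmod u = r, 6.-primitive_root z
                    & forall k : 'I_6, h k = c + u * z ^+ k].

Definition voronoi_cell (S : set C) (s : C) : set C :=
  [set x | forall s', S s' -> s' <> s -> cmod (x - s) <= cmod (x - s')].

Definition voronoi_vertex (S : set C) (v : C) :=
  exists s : 'I_3 -> C,
    injective s /\ forall k, S (s k) /\ voronoi_cell S (s k) v.

Definition edge_path (v w : C) (t : R) : C := (1 - t)%:C%C * v + t%:C%C * w.

Definition edge_segment (v w : C) : set C := edge_path v w @` `[0, 1].

(* The segment from v to w is a bounded edge: its endpoints are distinct
   vertices and it is the common boundary of two cells. *)
Definition voronoi_bounded_edge (S : set C) (v w : C) :=
  [/\ voronoi_vertex S v, voronoi_vertex S w, v <> w &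
      exists s s' : C, [/\ S s, S s', s <> s' &
        voronoi_cell S s `&` voronoi_cell S s' = edge_segment v w]].

Definition exactly_n_simple_roots (n : nat) (p : {poly C}) :=
  exists r : seq C, [/\ uniq r, size r = n, (forall z, root p z = (z \in r))
                      & forall z, z \in r -> mup z p = 1%N].

Definition branches (f : {poly {poly C}}) (n : nat) (v w : C)
    (y : 'I_n -> R -> C) :=
  [/\ forall k, {within `[0, 1], continuous (y k : R -> C^o)},
      forall k (t : R), 0 <= t <= 1 ->
        root (fiber f (edge_path v w t)) (y k t),
      injective (fun k => y k 0)
    & forall z, root (fiber f v) z -> exists k, y k 0 = z].

(* The complex numbers an algorithm may approximate: the endpoints of the
   edge and the coefficients of f. *)
Definition edge_data (f : {poly {poly C}}) (v w : C) (k : nat) : C :=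
  match k with
  | 0 => v
  | 1 => w
  | k'.+2 => let: (i, j) := Cantor.of_nat k' in f`_j`_i
  end.

(* The exactly known data: the degrees of f in y and in x.  (sizeY is one
   plus the degree in the inner variable.) *)
Definition edge_degrees (f : {poly {poly C}}) : nat :=
  npair (size f).-1 (sizeY f).-1.

End Complex.

(* Main.v *)
Require Import Defs.
From HB Require Import structures.
From mathcomp Require Import all_boot all_order all_algebra finmap polyXY.
From mathcomp Require Import complex.
From mathcomp Require Import all_classical reals topology normedtype.
From mathcomp Require Import ring lra.
From mathcomp Require Import derive.

Set Implicit Arguments.
Unset Strict Implicit.
Unset Printing Implicit Defensive.

Import Order.TTheory GRing.Theory Num.Theory.
Import numFieldNormedType.Exports.
Local Open Scope classical_set_scope.
Local Open Scope ring_scope.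

(** Write [F(t, y)] for [f] at the point of parameter [t] of the edge and at
    [y].  A single radius [eps] and a uniform subdivision into [N] steps are
    enough, and both follow from a lower bound [delta] on [|F_y|] at all roots:
    by Taylor's formula two roots over the same [t] are more than [eps] apart,
    and [F(t, .)] is bounded below on the circle of radius [eps] about a root,
    so that [F(t', .)] has no zero on that circle for [t'] close to [t].  By the
    intermediate value theorem the distance between a branch and the starting
    value of a branch then stays on its side of [eps] during a whole step
    ([branch_isolation]).

    To find [delta], the program looks for two numbers [P] and [D] that pass a
    finite test in rational arithmetic.  On a grid in [t] the leading coefficient
    is at least about [1 / P]; this bounds all roots, by Cauchy.  On a grid in
    [t] and in the resulting range of [y], one of [|F|] and [|F_y|] is at least
    [1 / D].  The width of the grid and the precision asked of the oracle are
    explicit functions of [P] and [D], chosen through an explicit Lipschitz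
    constant of [F] in all its data ([dpoly_lipschitz]), so that a passed test
    holds, up to a factor 2, for the exact data at every point
    ([certified_deriv]); in particular [|F_y| >= 1 / (2 (D + 1))] at all roots.

    The search ends because the roots over the edge are simple and [n] in number:
    the leading coefficient, and [|F| + |F_y|], have positive minima over compact
    boxes ([box_lower_bound], [test_complete]).

    That the search is a program in the sense of [code] rests on closure
    properties of the functions computable from the oracle, uniformly in the
    oracle. *)

(** * Oracle-computable functions *)

Definition pfst (e : nat) : nat := (Cantor.of_nat e).1.
Definition psnd (e : nat) : nat := (Cantor.of_nat e).2.

Lemma pfst_npair x y : pfst (npair x y) = x.
Proof. by rewrite /pfst /npair Cantor.cancel_of_to. Qed.

Lemma psnd_npair x y : psnd (npair x y) = y.
Proof. by rewrite /psnd /npair Cantor.cancel_of_to. Qed.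

Lemma npair_eta e : npair (pfst e) (psnd e) = e.
Proof.
by rewrite /npair /pfst /psnd -surjective_pairing Cantor.cancel_to_of.
Qed.

Definition pairE := (pfst_npair, psnd_npair).

Definition computable (F : (nat -> nat) -> nat -> nat) :=
  exists c, forall o a, Defs.eval o c a (F o a).

Lemma computable_ext F G :
  (forall o a, F o a = G o a) -> computable F -> computable G.
Proof. by move=> FG [c Hc]; exists c => o a; rewrite -FG. Qed.

Create HintDb computability discriminated.
Hint Constants Opaque : computability.
Ltac computability := solve [auto 200 with computability nocore].

Lemma computable_id : computable (fun _ a => a).
Proof.
exists (Pair Fst Snd) => o a; rewrite -{2}(npair_eta a).
exact: eval_pair (eval_fst _ _) (eval_snd _ _).
Qed.
Hint Resolve computable_id : computability.

Lemma computable_const k : computable (fun _ _ => k).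
Proof.
elim: k => [|k [c Hc]]; first by exists Zero => o a; exact: eval_zero.
exists (Comp Succ c) => o a; exact: eval_comp (Hc o a) (eval_succ o k).
Qed.
Hint Resolve computable_const : computability.

Lemma computable_comp F G :
  computable F -> computable G -> computable (fun o a => F o (G o a)).
Proof.
move=> [c Hc] [d Hd]; exists (Comp c d) => o a.
exact: eval_comp (Hd o a) (Hc o _).
Qed.

Hint Extern 1 (computable _) =>
  match goal with
  | H : computable ?F |- computable (fun o a => ?F o (@?G o a)) =>
      refine (@computable_comp F G H _)
  end : computability.

Lemma computable_fst F : computable F -> computable (fun o a => pfst (F o a)).
Proof.
move=> [c Hc]; exists (Comp Fst c) => o a.
exact: eval_comp (Hc o a) (eval_fst _ _).
Qed.
Hint Resolve computable_fst : computability.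

Lemma computable_snd F : computable F -> computable (fun o a => psnd (F o a)).
Proof.
move=> [c Hc]; exists (Comp Snd c) => o a.
exact: eval_comp (Hc o a) (eval_snd _ _).
Qed.
Hint Resolve computable_snd : computability.

Lemma computable_succ F : computable F -> computable (fun o a => (F o a).+1).
Proof.
move=> [c Hc]; exists (Comp Succ c) => o a.
exact: eval_comp (Hc o a) (eval_succ _ _).
Qed.
Hint Resolve computable_succ : computability.

Lemma computable_oracle F : computable F -> computable (fun o a => o (F o a)).
Proof.
move=> [c Hc]; exists (Comp Oracle c) => o a.
exact: eval_comp (Hc o a) (eval_oracle _ _).
Qed.
Hint Resolve computable_oracle : computability.

Lemma computable_pair F G :
  computable F -> computable G -> computable (fun o a => npair (F o a) (G o a)).
Proof.
move=> [c Hc] [d Hd]; exists (Pair c d) => o a.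
exact: eval_pair (Hc o a) (Hd o a).
Qed.
Hint Resolve computable_pair : computability.

(** Binary operations are passed around uncurried; this lemma curries them
    back, so that closure under a new operation costs one application. *)
Lemma computable_op2 (op : (nat -> nat) -> nat -> nat -> nat) :
  computable (fun o e => op o (pfst e) (psnd e)) ->
  forall F G, computable F -> computable G ->
  computable (fun o a => op o (F o a) (G o a)).
Proof.
move=> opC F G FC GC.
apply: computable_ext (computable_comp opC (computable_pair FC GC)) => o a.
by rewrite !pairE.
Qed.

Fixpoint primrec (z : nat) (s : nat -> nat -> nat) (n : nat) : nat :=
  if n is m.+1 then s m (primrec z s m) else z.

Lemma computable_primrec Z S N :
  computable Z ->
  computable (fun o e => S o (pfst e) (pfst (psnd e)) (psnd (psnd e))) ->
  computable N -> computable (fun o a => primrec (Z o a) (S o a) (N o a)).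
Proof.
move=> [z Hz] [s Hs] [n Hn].
exists (Comp (Prec z s) (Pair (Pair Fst Snd) n)) => o a.
apply: (@eval_comp _ _ _ _ (npair a (N o a))).
  apply: eval_pair (Hn o a); rewrite -{2}(npair_eta a).
  exact: eval_pair (eval_fst _ _) (eval_snd _ _).
elim: (N o a) => [|m IHm] /=; first exact/eval_prec0/Hz.
apply: eval_precS IHm _.
by move: (Hs o (npair a (npair m (primrec (Z o a) (S o a) m)))); rewrite !pairE.
Qed.
Hint Resolve computable_primrec : computability.

Lemma computable_add F G :
  computable F -> computable G -> computable (fun o a => F o a + G o a)%N.
Proof.
move=> FC GC.
have: computable (fun o a => primrec (F o a) (fun _ r => r.+1) (G o a)).
  by computability.
apply: computable_ext => o a.
by elim: (G o a) => [|m IHm] /=; rewrite ?addn0 // IHm addnS.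
Qed.
Hint Resolve computable_add : computability.

Lemma computable_mul F G :
  computable F -> computable G -> computable (fun o a => F o a * G o a)%N.
Proof.
move=> FC GC.
have: computable (fun o a => primrec 0 (fun _ r => r + F o a)%N (G o a)).
  by computability.
apply: computable_ext => o a.
by elim: (G o a) => [|m IHm] /=; rewrite ?muln0 // IHm mulnS addnC.
Qed.
Hint Resolve computable_mul : computability.

Lemma computable_pred F : computable F -> computable (fun o a => (F o a).-1).
Proof.
move=> FC.
have: computable (fun o a => primrec 0 (fun k _ => k) (F o a)) by computability.
by apply: computable_ext => o a; case: (F o a).
Qed.
Hint Resolve computable_pred : computability.

Lemma computable_sub F G :
  computable F -> computable G -> computable (fun o a => F o a - G o a)%N.
Proof.
move=> FC GC.
have: computable (fun o a => primrec (F o a) (fun _ r => r.-1) (G o a)).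
  by computability.
apply: computable_ext => o a.
by elim: (G o a) => [|m IHm] /=; rewrite ?subn0 // IHm subnS.
Qed.
Hint Resolve computable_sub : computability.

Lemma computable_leq F G :
  computable F -> computable G -> computable (fun o a => F o a <= G o a : nat)%N.
Proof.
move=> FC GC.
have: computable (fun o a => 1 - (F o a - G o a))%N by computability.
apply: computable_ext => o a; rewrite /leq.
by case: (F o a - G o a)%N => // k; rewrite subSS sub0n.
Qed.
Hint Resolve computable_leq : computability.

Lemma computable_neg (T : (nat -> nat) -> nat -> bool) :
  computable (fun o a => T o a : nat) -> computable (fun o a => ~~ T o a : nat).
Proof.
move=> TC; have: computable (fun o a => 1 - T o a)%N by computability.
by apply: computable_ext => o a; case: (T o a).
Qed.
Hint Resolve computable_neg : computability.

Lemma computable_and (T U : (nat -> nat) -> nat -> bool) :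
  computable (fun o a => T o a : nat) -> computable (fun o a => U o a : nat) ->
  computable (fun o a => T o a && U o a : nat).
Proof.
move=> TC UC; have: computable (fun o a => T o a * U o a)%N by computability.
by apply: computable_ext => o a; rewrite mulnb.
Qed.
Hint Resolve computable_and : computability.

Lemma computable_or (T U : (nat -> nat) -> nat -> bool) :
  computable (fun o a => T o a : nat) -> computable (fun o a => U o a : nat) ->
  computable (fun o a => T o a || U o a : nat).
Proof.
move=> TC UC.
have: computable (fun o a => ~~ (~~ T o a && ~~ U o a) : nat) by computability.
by apply: computable_ext => o a; case: (T o a); case: (U o a).
Qed.
Hint Resolve computable_or : computability.

Definition all_below (T : nat -> bool) (n : nat) : bool := all T (iota 0 n).

Lemma all_belowP (T : nat -> bool) n :
  reflect (forall k, (k < n)%N -> T k) (all_below T n).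
Proof.
apply: (iffP allP) => H k; last by rewrite mem_iota => /H.
by move=> kn; apply: H; rewrite mem_iota.
Qed.

Lemma computable_all_below (T : (nat -> nat) -> nat -> nat -> bool) N :
  computable (fun o e => T o (pfst e) (psnd e) : nat) -> computable N ->
  computable (fun o a => all_below (T o a) (N o a) : nat).
Proof.
move=> TC NC.
have: computable (fun o a => primrec 1 (fun k r => r * T o a k)%N (N o a)).
  apply: computable_primrec => //; first exact: computable_const.
  apply: computable_mul; first by computability.
  by apply: (computable_op2 (op := fun o a k => T o a k)); computability.
apply: computable_ext => o a; rewrite /all_below.
elim: (N o a) => [|m IHm] //; rewrite [primrec _ _ _]/= IHm -[in RHS]addn1.
by rewrite iotaD all_cat /= andbT mulnb.
Qed.
Hint Resolve computable_all_below : computability.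

Lemma computable_expn F G :
  computable F -> computable G -> computable (fun o a => F o a ^ G o a)%N.
Proof.
move=> FC GC.
have: computable (fun o a => primrec 1 (fun _ r => r * F o a)%N (G o a)).
  by computability.
apply: computable_ext => o a.
by elim: (G o a) => [|m IHm] //=; rewrite IHm expnSr.
Qed.
Hint Resolve computable_expn : computability.

Lemma computable_ffact F G :
  computable F -> computable G -> computable (fun o a => F o a ^_ G o a)%N.
Proof.
move=> FC GC.
have: computable (fun o a => primrec 1 (fun k r => r * (F o a - k))%N (G o a)).
  by computability.
apply: computable_ext => o a.
by elim: (G o a) => [|m IHm] //=; rewrite IHm ffactnSr.
Qed.
Hint Resolve computable_ffact : computability.

Lemma computable_fact F : computable F -> computable (fun o a => (F o a)`!).
Proof.
move=> FC; have: computable (fun o a => F o a ^_ F o a)%N by computability.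
by apply: computable_ext => o a; rewrite ffactnn.
Qed.
Hint Resolve computable_fact : computability.

(** Consing from the back turns a list comprehension into a recursion on its
    length, the only recursion that programs have. *)
Lemma computable_mkseq (u : (nat -> nat) -> nat -> nat -> nat) N :
  computable (fun o e => u o (pfst e) (psnd e)) -> computable N ->
  computable (fun o a => seq_code (mkseq (u o a) (N o a))).
Proof.
move=> uC NC.
have: computable (fun o a => primrec 0
    (fun k r => (npair (u o a (N o a - k.+1)%N) r).+1) (N o a)).
  apply: computable_primrec => //; first exact: computable_const.
  apply/computable_succ/computable_pair; last by computability.
  apply: (computable_op2 (op := u)) => //; first by computability.
  by computability.
apply: computable_ext => o a.
have E m : (m <= N o a)%N ->
    primrec 0 (fun k r => (npair (u o a (N o a - k.+1)%N) r).+1) m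
    = seq_code [seq u o a i | i <- iota (N o a - m) m].
  elim: m => [|m IHm] //= mN; rewrite IHm ?(ltnW mN) //.
  by rewrite subnSK.
by rewrite E // subnn.
Qed.
Hint Resolve computable_mkseq : computability.

Lemma search_program (T : (nat -> nat) -> nat -> nat -> bool) :
  computable (fun o e => T o (pfst e) (psnd e) : nat) ->
  exists c, forall o a, (exists m, T o a m) ->
    exists2 m, T o a m & Defs.eval o c a m.
Proof.
move=> /computable_neg[c Hc]; exists (Mu c) => o a Tex.
case: (ex_minnP Tex) => m Tm mmin; exists m => //.
have evT k : Defs.eval o c (npair a k) (~~ T o a k).
  by have := Hc o (npair a k); rewrite !pairE.
apply: (@eval_mu _ _ _ _ (fun=> 0%N)) => [k km|]; last first.
  by have := evT m; rewrite Tm.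
have /negPf Tk : ~~ T o a k by apply/negP => /mmin; rewrite leqNgt km.
by have := evT k; rewrite Tk.
Qed.

(** * Arithmetic of coded Gaussian rationals *)

Definition qadd (c d : nat) : nat :=
  npair (npair (pfst (pfst c) * (psnd d).+1 + pfst (pfst d) * (psnd c).+1)
               (psnd (pfst c) * (psnd d).+1 + psnd (pfst d) * (psnd c).+1))
        (psnd c * psnd d + psnd c + psnd d).

Definition qmul (c d : nat) : nat :=
  npair (npair (pfst (pfst c) * pfst (pfst d) + psnd (pfst c) * psnd (pfst d))
               (pfst (pfst c) * psnd (pfst d) + psnd (pfst c) * pfst (pfst d)))
        (psnd c * psnd d + psnd c + psnd d).

Definition qopp (c : nat) : nat :=
  npair (npair (psnd (pfst c)) (pfst (pfst c))) (psnd c).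

Definition qfrac (p b : nat) : nat := npair (npair p 0) b.

(** This is [|p - q|]: one of the two truncated differences vanishes. *)
Definition qnum (c : nat) : nat :=
  (pfst (pfst c) - psnd (pfst c)) + (psnd (pfst c) - pfst (pfst c)).

Definition qlarge (D c : nat) : bool := (psnd c < D.+1 * qnum c)%N.
Definition qbounded (P c : nat) : bool := (qnum c <= P * (psnd c).+1)%N.

Definition gadd (c d : nat) : nat :=
  npair (qadd (pfst c) (pfst d)) (qadd (psnd c) (psnd d)).

Definition gmul (c d : nat) : nat :=
  npair (qadd (qmul (pfst c) (pfst d)) (qopp (qmul (psnd c) (psnd d))))
        (qadd (qmul (pfst c) (psnd d)) (qmul (psnd c) (pfst d))).

Definition gopp (c : nat) : nat := npair (qopp (pfst c)) (qopp (psnd c)).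

Definition gfrac (p b : nat) : nat := npair (qfrac p b) (qfrac 0 0).

Definition gsum (F : nat -> nat) (n : nat) : nat :=
  primrec (gfrac 0 0) (fun k r => gadd r (F k)) n.

Definition gpow (c n : nat) : nat :=
  primrec (gfrac 1 0) (fun _ r => gmul r c) n.

(** Comparing coordinates instead of the modulus keeps the test a comparison of
    integers.  The price is a factor 2 between the sufficient condition
    [glarge_upper] and the necessary condition [glarge_lower]. *)
Definition glarge (D c : nat) : bool := qlarge D (pfst c) || qlarge D (psnd c).
Definition gbounded (P c : nat) : bool :=
  qbounded P (pfst c) && qbounded P (psnd c).

Lemma computable_gadd F G :
  computable F -> computable G -> computable (fun o a => gadd (F o a) (G o a)).
Proof.
apply: (computable_op2 (op := fun=> gadd)).
by rewrite /gadd /qadd; computability.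
Qed.

Lemma computable_gmul F G :
  computable F -> computable G -> computable (fun o a => gmul (F o a) (G o a)).
Proof.
apply: (computable_op2 (op := fun=> gmul)).
by rewrite /gmul /qadd /qmul /qopp; computability.
Qed.

Lemma computable_gopp F : computable F -> computable (fun o a => gopp (F o a)).
Proof. by move=> FC; rewrite /gopp /qopp; computability. Qed.

Lemma computable_qfrac F G :
  computable F -> computable G -> computable (fun o a => qfrac (F o a) (G o a)).
Proof. by move=> FC GC; rewrite /qfrac; computability. Qed.

Lemma computable_gfrac F G :
  computable F -> computable G -> computable (fun o a => gfrac (F o a) (G o a)).
Proof. by move=> FC GC; rewrite /gfrac /qfrac; computability. Qed.

Lemma computable_glarge F G :
  computable F -> computable G ->
  computable (fun o a => glarge (F o a) (G o a) : nat).
Proof.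
apply: (computable_op2 (op := fun _ c d => glarge c d)).
by rewrite /glarge /qlarge /qnum; computability.
Qed.

Lemma computable_gbounded F G :
  computable F -> computable G ->
  computable (fun o a => gbounded (F o a) (G o a) : nat).
Proof.
apply: (computable_op2 (op := fun _ c d => gbounded c d)).
by rewrite /gbounded /qbounded /qnum; computability.
Qed.

Hint Resolve computable_gadd computable_gmul computable_gopp computable_qfrac
  computable_gfrac computable_glarge computable_gbounded : computability.

Lemma computable_gsum (F : (nat -> nat) -> nat -> nat -> nat) N :
  computable (fun o e => F o (pfst e) (psnd e)) -> computable N ->
  computable (fun o a => gsum (F o a) (N o a)).
Proof.
move=> FC NC; apply: computable_primrec => //; first by computability.
apply: computable_gadd; first by computability.
by apply: (computable_op2 (op := F)); computability.
Qed.

Lemma computable_gpow F G :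
  computable F -> computable G -> computable (fun o a => gpow (F o a) (G o a)).
Proof.
apply: (computable_op2 (op := fun=> gpow)); rewrite /gpow; computability.
Qed.

Hint Resolve computable_gsum computable_gpow : computability.

Definition qval (R : realType) (c : nat) : R :=
  ((pfst (pfst c))%:R - (psnd (pfst c))%:R) / (psnd c).+1%:R.

Definition gval (R : realType) (c : nat) : R[i] :=
  Complex (qval R (pfst c)) (qval R (psnd c)).

Section CodeValues.
Variable R : realType.
Local Notation C := R[i].

Lemma ratr_rat_of_code c : ratr (rat_of_code c) = qval R c.
Proof.
rewrite /rat_of_code /qval /pfst /psnd.
case: (Cantor.of_nat c) => a b; case: (Cantor.of_nat a) => p q /=.
by rewrite rmorphM fmorphV /= ratr_int rmorph_nat rmorphB.
Qed.

Lemma qval_add c d : qval R (qadd c d) = qval R c + qval R d.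
Proof.
rewrite /qval /qadd !pairE.
have -> : (psnd c * psnd d + psnd c + psnd d).+1
  = ((psnd c).+1 * (psnd d).+1)%N by ring.
rewrite !natrD !natrM; field.
by rewrite !nat1r !pnatr_eq0.
Qed.

Lemma qval_mul c d : qval R (qmul c d) = qval R c * qval R d.
Proof.
rewrite /qval /qmul !pairE.
have -> : (psnd c * psnd d + psnd c + psnd d).+1
  = ((psnd c).+1 * (psnd d).+1)%N by ring.
rewrite !natrD !natrM; field.
by rewrite !nat1r !pnatr_eq0.
Qed.

Lemma qval_opp c : qval R (qopp c) = - qval R c.
Proof. by rewrite /qval /qopp !pairE -mulNr opprB. Qed.

Lemma qval_frac p b : qval R (qfrac p b) = p%:R / b.+1%:R.
Proof. by rewrite /qval /qfrac !pairE subr0. Qed.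

Lemma normr_qval c : `|qval R c| = (qnum c)%:R / (psnd c).+1%:R.
Proof.
rewrite /qval /qnum normrM normfV (ger0_norm (ler0n _ _)); congr (_ / _).
case: (leqP (pfst (pfst c)) (psnd (pfst c))) => [le|/ltnW le].
  move: (le); rewrite -subn_eq0 => /eqP ->; rewrite add0n natrB //.
  by rewrite distrC ger0_norm // subr_ge0 ler_nat.
move: (le); rewrite -subn_eq0 => /eqP ->; rewrite addn0 natrB //.
by rewrite ger0_norm // subr_ge0 ler_nat.
Qed.

Lemma qlargeE D c : qlarge D c = (D.+1%:R^-1 <= `|qval R c|).
Proof.
rewrite /qlarge normr_qval ler_pdivlMr ?ltr0n // mulrC ler_pdivrMr ?ltr0n //.
by rewrite -natrM ler_nat mulnC.
Qed.

Lemma qboundedE P c : qbounded P c = (`|qval R c| <= P%:R).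
Proof.
by rewrite /qbounded normr_qval ler_pdivrMr ?ltr0n // -natrM ler_nat.
Qed.

Lemma gval_add c d : gval R (gadd c d) = gval R c + gval R d.
Proof. by rewrite /gval /gadd !pairE !qval_add. Qed.

Lemma gval_mul c d : gval R (gmul c d) = gval R c * gval R d.
Proof. by rewrite /gval /gmul !pairE !(qval_add, qval_opp, qval_mul). Qed.

Lemma gval_opp c : gval R (gopp c) = - gval R c.
Proof. by rewrite /gval /gopp !pairE !qval_opp. Qed.

Lemma gval_frac p b : gval R (gfrac p b) = (p%:R / b.+1%:R)%:C%C.
Proof. by rewrite /gval /gfrac !pairE !qval_frac mul0r. Qed.

Lemma gval_sum F n : gval R (gsum F n) = \sum_(k < n) gval R (F k).
Proof.
elim: n => [|n IHn]; first by rewrite big_ord0 gval_frac mul0r.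
by rewrite big_ord_recr /= -IHn gval_add.
Qed.

Lemma gval_pow c n : gval R (gpow c n) = gval R c ^+ n.
Proof.
elim: n => [|n IHn]; first by rewrite expr0 gval_frac divr1.
by rewrite exprSr -IHn -gval_mul.
Qed.

Lemma cmod_ge0 (z : C) : 0 <= cmod z.
Proof. by case: z => a b; exact: sqrtr_ge0. Qed.

Lemma cmod_ge_re (a b : R) : `|a| <= cmod (Complex a b).
Proof. by rewrite -sqrtr_sqr ler_wsqrtr // lerDl sqr_ge0. Qed.

Lemma cmod_ge_im (a b : R) : `|b| <= cmod (Complex a b).
Proof. by rewrite -sqrtr_sqr ler_wsqrtr // lerDr sqr_ge0. Qed.

Lemma cmod_le_re_im (a b : R) : cmod (Complex a b) <= `|a| + `|b|.
Proof.
rewrite /= -[leRHS]ger0_norm ?addr_ge0 // -sqrtr_sqr ler_wsqrtr //.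
rewrite sqrrD !real_normK ?num_real // -addrA lerD2l lerDr.
by rewrite mulrn_wge0 // mulr_ge0.
Qed.

Lemma cmodD (x y : C) : cmod (x + y) <= cmod x + cmod y.
Proof. exact: le_normcD. Qed.

Lemma cmodN (x : C) : cmod (- x) = cmod x.
Proof. exact: normcN. Qed.

Lemma cmodM (x y : C) : cmod (x * y) = cmod x * cmod y.
Proof. exact: ComplexField.Normc.normcM. Qed.

Lemma cmodBC (x y : C) : cmod (x - y) = cmod (y - x).
Proof. by rewrite -cmodN opprB. Qed.

Lemma cmod0 : cmod (0 : C) = 0.
Proof. exact: ComplexField.Normc.normc0. Qed.

Lemma cmod_eq0 (x : C) : (cmod x == 0) = (x == 0).
Proof.
apply/eqP/eqP => [/ComplexField.Normc.eq0_normc //|->]; exact: cmod0.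
Qed.

Lemma cmod_gt0 (x : C) : (0 < cmod x) = (x != 0).
Proof. by rewrite lt_neqAle cmod_ge0 andbT eq_sym cmod_eq0. Qed.

Lemma cmod_real (a : R) : cmod (a%:C%C) = `|a|.
Proof. by rewrite /= expr0n addr0 sqrtr_sqr. Qed.

Lemma cmod_nat n : cmod (n%:R : C) = n%:R.
Proof. by rewrite -(rmorph_nat (real_complex R)) cmod_real ger0_norm. Qed.

Lemma cmodX (x : C) n : cmod (x ^+ n) = cmod x ^+ n.
Proof.
elim: n => [|n IHn]; first exact: (cmod_nat 1).
by rewrite !exprS cmodM IHn.
Qed.

Lemma cmod_sum n (F : 'I_n -> C) :
  cmod (\sum_(k < n) F k) <= \sum_(k < n) cmod (F k).
Proof.
elim/big_ind2: _ => [|x y z t xy zt|//]; first by rewrite cmod0.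
exact: le_trans (cmodD _ _) (lerD xy zt).
Qed.

Lemma cmod_sub_trans (y x z : C) : cmod (x - z) <= cmod (x - y) + cmod (y - z).
Proof. have -> : x - z = (x - y) + (y - z) by ring. exact: cmodD. Qed.

Lemma cmod_le_sub (x y : C) : cmod x <= cmod y + cmod (x - y).
Proof. have {1}-> : x = y + (x - y) by ring. exact: cmodD. Qed.

Lemma glarge_lower D c : glarge D c -> D.+1%:R^-1 <= cmod (gval R c).
Proof.
rewrite /glarge !qlargeE => /orP[] /le_trans; apply.
- exact: cmod_ge_re.
- exact: cmod_ge_im.
Qed.

Lemma glarge_upper D c : 2 * D.+1%:R^-1 <= cmod (gval R c) -> glarge D c.
Proof.
rewrite /glarge !qlargeE => /le_trans/(_ (cmod_le_re_im _ _)).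
move: (D.+1%:R^-1) `|_| `|_| => e x y.
by case: (lerP e x) => //= h1; case: (lerP e y) => //= h2; lra.
Qed.

Lemma gbounded_cmod P c : gbounded P c -> cmod (gval R c) <= P%:R *+ 2.
Proof.
rewrite /gbounded !qboundedE => /andP[h1 h2].
by apply: le_trans (cmod_le_re_im _ _) _; rewrite mulr2n lerD.
Qed.

Lemma cmod_gbounded P c : cmod (gval R c) <= P%:R -> gbounded P c.
Proof.
move=> h; rewrite /gbounded !qboundedE.
by rewrite !(le_trans _ h) ?cmod_ge_re ?cmod_ge_im.
Qed.

End CodeValues.

(** * Polynomial estimates *)

Section Estimates.
Variable R : realType.
Local Notation C := R[i].

(** The [s]-th partial derivative in [y] of [\sum_(i, j) a j i x^i y^j].  The
    falling factorial makes one formula cover the three cases in use: the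
    polynomial ([s = 0]), its derivative ([s = 1]) and [n`!] times its leading
    coefficient ([s = n]). *)
Definition dpoly (n d s : nat) (a : nat -> nat -> C) (x y : C) : C :=
  \sum_(j < n.+1) \sum_(i < d.+1)
    (j ^_ s)%:R * (a j i * (x ^+ i * y ^+ (j - s))).

(** One crude constant for both the Lipschitz and the Taylor estimate: the
    number of monomials, times a bound on the weights [j ^_ s], times the
    square of the total degree, times a bound on the monomials themselves. *)
Definition lip (n d b : nat) : nat :=
  (n.+1 * d.+1 * (n`! * ((n + d).+1 ^ 2 * b ^ (n + d).+1)))%N.

Lemma cmod_mul_sub (u u' v v' : C) (U V al be : R) :
  cmod u' <= U -> cmod v <= V -> cmod (u - u') <= al -> cmod (v - v') <= be ->
  cmod (u * v - u' * v') <= al * V + U * be.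
Proof.
move=> hU hV hal hbe; have -> : u * v - u' * v' = (u - u') * v + u' * (v - v').
  by ring.
apply: le_trans (cmodD _ _) _; rewrite !cmodM.
by apply: lerD; apply: ler_pM; rewrite ?cmod_ge0.
Qed.

Lemma cmodX_le (x : C) (b : R) k : cmod x <= b -> cmod (x ^+ k) <= b ^+ k.
Proof. by move=> h; rewrite cmodX lerXn2r // nnegrE ?(le_trans _ h) ?cmod_ge0. Qed.

Lemma cmodX_sub (b eta : R) (x x' : C) k :
  1 <= b -> cmod x <= b -> cmod x' <= b -> cmod (x - x') <= eta ->
  cmod (x ^+ k - x' ^+ k) <= k%:R * b ^+ k * eta.
Proof.
move=> b1 hx hx' hd; have b0 : 0 <= b by lra.
have e0 : 0 <= eta := le_trans (cmod_ge0 _) hd.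
elim: k => [|k IHk]; first by rewrite subrr cmod0 !mul0r.
rewrite !exprS; apply: le_trans (cmod_mul_sub hx' (cmodX_le k hx) hd IHk) _.
have bk : 0 <= b ^+ k by exact: exprn_ge0.
have h : eta * b ^+ k <= eta * (b * b ^+ k).
  by rewrite ler_wpM2l // ler_peMl.
rewrite -(addn1 k) natrD; lra.
Qed.

(** The remainder [e_k] satisfies
    [e_(k+1) = y e_k + k z^(k-1) (y - z)^2], whence a quadratic factor [k^2]. *)
Lemma cmodX_taylor (b : R) (y z : C) k :
  1 <= b -> cmod y <= b -> cmod z <= b ->
  cmod (y ^+ k - z ^+ k - k%:R * z ^+ k.-1 * (y - z))
    <= (k ^ 2)%:R * b ^+ k * cmod (y - z) ^+ 2.
Proof.
move=> b1 hy hz; have b0 : 0 <= b by lra.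
elim: k => [|k IHk].
  by rewrite !expr0 subrr !mul0r subr0 cmod0.
rewrite [k.+1.-1]/=.
have -> : y ^+ k.+1 - z ^+ k.+1 - k.+1%:R * z ^+ k * (y - z)
  = y * (y ^+ k - z ^+ k - k%:R * z ^+ k.-1 * (y - z))
    + k%:R * z ^+ k.-1 * (y - z) ^+ 2.
  case: k {IHk} => [|k]; first by rewrite !expr1 !expr0; ring.
  by rewrite /= -natr1 !exprS -natr1; ring.
apply: le_trans (cmodD _ _) _; rewrite !cmodM cmod_nat -expr2.
set h := cmod (y - z) ^+ 2; have h0 : 0 <= h by rewrite exprn_ge0 ?cmod_ge0.
have zk : cmod (z ^+ k.-1) <= b * b ^+ k.
  apply: le_trans (cmodX_le _ hz) _; rewrite -exprS ler_weXn2l //.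
  exact: leq_trans (leq_pred k) (leqnSn k).
have t1 := ler_pM (cmod_ge0 _) (cmod_ge0 _) hy IHk.
have t2 : k%:R * cmod (z ^+ k.-1) * h <= k%:R * (b * b ^+ k) * h.
  by rewrite ler_wpM2r // ler_wpM2l // ler0n.
apply: le_trans (lerD t1 t2) _; rewrite -/h exprS -subr_ge0.
have -> : (k.+1 ^ 2)%:R * (b * b ^+ k) * h
    - (b * ((k ^ 2)%:R * b ^+ k * h) + k%:R * (b * b ^+ k) * h)
  = (k%:R + 1) * (b * b ^+ k) * h.
  by rewrite !natrX -natr1; ring.
by rewrite !mulr_ge0 ?addr_ge0 ?exprn_ge0 ?ler0n ?ler01 ?cmod_ge0.
Qed.

Lemma ffact_le_fact j s n : (j <= n)%N -> (j ^_ s <= n`!)%N.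
Proof.
move=> jn; case: (leqP s j) => [sj|js]; last by rewrite ffact_small.
apply: leq_trans (leq_fact jn).
by rewrite -(ffact_fact sj) leq_pmulr ?fact_gt0.
Qed.

Lemma cmod_dsum_le n d (F G : nat -> nat -> C) (K : R) :
  (forall j i, (j <= n)%N -> (i <= d)%N -> cmod (F j i) <= K) ->
  cmod (\sum_(j < n.+1) \sum_(i < d.+1) F j i) <= (n.+1 * d.+1)%:R * K.
Proof.
move=> FK; apply: le_trans (cmod_sum _) _.
have -> : (n.+1 * d.+1)%:R * K = \sum_(j < n.+1) \sum_(i < d.+1) K.
  by rewrite !sumr_const !card_ord -mulrnA mulr_natl mulnC.
apply: ler_sum => j _; apply: le_trans (cmod_sum _) _; apply: ler_sum => i _.
by apply: FK; rewrite -ltnS ltn_ord.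
Qed.

(** All the data of [dpoly] vary together, because the program sees
    approximations of the coefficients as well as of the point. *)
Lemma dpoly_lipschitz n d s b (a a' : nat -> nat -> C) x x' y y' (eta : R) :
  (0 < b)%N ->
  (forall j i, cmod (a j i) <= b%:R) -> (forall j i, cmod (a' j i) <= b%:R) ->
  cmod x <= b%:R -> cmod x' <= b%:R -> cmod y <= b%:R -> cmod y' <= b%:R ->
  (forall j i, cmod (a j i - a' j i) <= eta) ->
  cmod (x - x') <= eta -> cmod (y - y') <= eta ->
  cmod (dpoly n d s a x y - dpoly n d s a' x' y') <= (lip n d b)%:R * eta.
Proof.
move=> b_gt0 ha ha' hx hx' hy hy' da dx dy.
have e0 : 0 <= eta := le_trans (cmod_ge0 _) dx.
have b1 : 1 <= b%:R :> R by rewrite ler1n.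
have b0 : 0 <= b%:R :> R by rewrite ler0n.
rewrite /lip natrM -mulrA /dpoly -sumrB.
under eq_bigr => j _ do rewrite -sumrB.
apply: (@cmod_dsum_le n d (fun j i =>
  (j ^_ s)%:R * (a j i * (x ^+ i * y ^+ (j - s)))
  - (j ^_ s)%:R * (a' j i * (x' ^+ i * y' ^+ (j - s))))) => // j i jn id.
rewrite -mulrBr cmodM cmod_nat natrM -mulrA.
apply: ler_pM => //; rewrite ?ler0n ?cmod_ge0 ?ler_nat ?ffact_le_fact //.
set k := (j - s)%N; have kn : (k <= n)%N by rewrite (leq_trans (leq_subr _ _)).
have xy := cmod_mul_sub (cmodX_le i hx') (cmodX_le k hy)
  (cmodX_sub i b1 hx hx' dx) (cmodX_sub k b1 hy hy' dy).
have xyb : cmod (x ^+ i * y ^+ k) <= b%:R ^+ i * b%:R ^+ k.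
  by rewrite cmodM ler_pM ?cmod_ge0 ?cmodX_le.
apply: le_trans (cmod_mul_sub (ha' j i) xyb (da j i) xy) _.
have -> : eta * (b%:R ^+ i * b%:R ^+ k) + b%:R * (i%:R * b%:R ^+ i * eta * b%:R ^+ k
    + b%:R ^+ i * (k%:R * b%:R ^+ k * eta))
  = eta * b%:R ^+ (i + k) + (i + k)%:R * b%:R ^+ (i + k).+1 * eta.
  by rewrite exprS exprD natrD; ring.
apply: (@le_trans _ _ ((i + k).+1%:R * b%:R ^+ (i + k).+1 * eta)).
  rewrite -(natr1 (i + k)) !mulrDl mul1r addrC lerD2l.
  by rewrite mulrC ler_wpM2r // ler_weXn2l.
rewrite -!natrX -!natrM ler_wpM2r // ler_nat leq_mul //.
  apply: leq_trans (_ : (n + d).+1 <= _)%N; last by rewrite expnS expn1 leq_pmulr.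
  by rewrite ltnS addnC leq_add.
by rewrite leq_pexp2l // ltnS addnC leq_add.
Qed.

Lemma dpoly_taylor n d b (a : nat -> nat -> C) x y z :
  (0 < b)%N -> (forall j i, cmod (a j i) <= b%:R) ->
  cmod x <= b%:R -> cmod y <= b%:R -> cmod z <= b%:R ->
  cmod (dpoly n d 0 a x y - dpoly n d 0 a x z - dpoly n d 1 a x z * (y - z))
    <= (lip n d b)%:R * cmod (y - z) ^+ 2.
Proof.
move=> b_gt0 ha hx hy hz.
have b1 : 1 <= b%:R :> R by rewrite ler1n.
have b0 : 0 <= b%:R :> R by rewrite ler0n.
set h := cmod (y - z) ^+ 2; have h0 : 0 <= h by rewrite exprn_ge0 ?cmod_ge0.
rewrite /lip natrM -mulrA /dpoly mulr_suml -!sumrB.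
under eq_bigr => j _ do rewrite mulr_suml -!sumrB.
apply: (@cmod_dsum_le n d (fun j i =>
  (j ^_ 0)%:R * (a j i * (x ^+ i * y ^+ (j - 0)))
  - (j ^_ 0)%:R * (a j i * (x ^+ i * z ^+ (j - 0)))
  - (j ^_ 1)%:R * (a j i * (x ^+ i * z ^+ (j - 1))) * (y - z)))
  => // j i jn id.
rewrite ffactn0 ffactn1 !subn0 subn1.
have -> : 1%:R * (a j i * (x ^+ i * y ^+ j)) - 1%:R * (a j i * (x ^+ i * z ^+ j))
    - j%:R * (a j i * (x ^+ i * z ^+ j.-1)) * (y - z)
  = a j i * (x ^+ i * (y ^+ j - z ^+ j - j%:R * z ^+ j.-1 * (y - z))).
  by rewrite !mul1r; ring.
rewrite !cmodM.
have t := ler_pM (cmod_ge0 _) (cmod_ge0 _) (cmodX_le i hx)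
  (cmodX_taylor j b1 hy hz).
apply: le_trans (ler_pM (cmod_ge0 _) _ (ha j i) t) _.
  by rewrite mulr_ge0 ?cmod_ge0.
have -> : b%:R * (b%:R ^+ i * ((j ^ 2)%:R * b%:R ^+ j * cmod (y - z) ^+ 2))
  = (j ^ 2)%:R * b%:R ^+ (i + j).+1 * h.
  by rewrite -/h [b%:R ^+ (i + j).+1]exprS exprD; ring.
rewrite -natrX -!natrM ler_wpM2r // ler_nat.
apply: leq_trans (leq_pmull _ (fact_gt0 n)); apply: leq_mul.
  by rewrite leq_exp2r // (leq_trans jn) // leqW // leq_addr.
by rewrite leq_pexp2l // ltnS addnC leq_add.
Qed.

(** Cauchy's bound: beyond [B >= 1] the leading term outweighs the others. *)
Lemma root_bound n (c : nat -> C) (y : C) (M g B : R) :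
  (forall j, (j <= n)%N -> cmod (c j) <= M) -> g <= cmod (c n) -> 0 < g ->
  1 <= B -> n%:R * M <= B * g ->
  \sum_(j < n.+1) c j * y ^+ j = 0 -> cmod y <= B.
Proof.
move=> cM cg g0 B1 MB; rewrite big_ord_recr /= => /eqP.
case: (lerP (cmod y) B) => // yB; have y1 : 1 < cmod y by exact: le_lt_trans yB.
case: n => [|n] in cM cg MB *.
  rewrite big_ord0 add0r expr0 mulr1 => /eqP c0; move: cg.
  by rewrite c0 cmod0 leNgt g0.
rewrite addrC addr_eq0 => /eqP/(congr1 (fun z => cmod z)).
rewrite /= cmodN cmodM => E.
have M0 : 0 <= M := le_trans (cmod_ge0 _) (cM 0%N isT).
have : cmod (\sum_(j < n.+1) c j * y ^+ j) <= n.+1%:R * M * cmod y ^+ n.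
  apply: le_trans (cmod_sum _) _.
  have -> : n.+1%:R * M * cmod y ^+ n = \sum_(j < n.+1) M * cmod y ^+ n.
    by rewrite sumr_const card_ord -mulr_natl; ring.
  apply: ler_sum => j _; rewrite cmodM cmodX ler_pM ?exprn_ge0 ?cmod_ge0 //.
    by apply: cM; rewrite ltnW // ltn_ord.
  by rewrite ler_weXn2l ?(ltW y1) // -ltnS ltn_ord.
rewrite -E cmodX exprS mulrA => H.
have yn : 0 < cmod y ^+ n by apply: exprn_gt0; lra.
have : g * cmod y <= n.+1%:R * M.
  rewrite -(ler_pM2r yn); apply: le_trans H.
  by rewrite !ler_wpM2r ?(ltW yn) ?cmod_ge0.
move=> H'; have := le_trans H' MB; rewrite mulrC ler_pM2r //.
by move/(lt_le_trans yB); rewrite ltxx.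
Qed.

End Estimates.

(** * Fibres with simple roots *)

Section Fibres.
Variable R : realType.
Local Notation C := R[i].

(** Every condition on a fibre becomes a condition on [dpoly], which the program
    can evaluate. *)
Lemma fiber_derivn (f : {poly {poly C}}) n d s (x y : C) :
  size f = n.+1 -> (sizeY f <= d.+1)%N ->
  (fiber f x)^`(s).[y] = dpoly n d s (fun j i => f`_j`_i) x y.
Proof.
move=> sf sY; have -> : fiber f x = \sum_(j < n.+1) (f`_j).[x] *: 'X^j.
  by rewrite /fiber /map_poly sf poly_def.
rewrite raddf_sum horner_sum; apply: eq_bigr => j _.
rewrite /= derivnZ derivnXn hornerZ hornerMn hornerXn.
rewrite (@horner_coef_wide _ d.+1) ?(leq_trans (max_size_coefXY _ _)) //.
rewrite mulr_suml; apply: eq_bigr => i _.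
by rewrite -[_ *+ (j ^_ s)]mulr_natl; ring.
Qed.

(** The zero polynomial has too many roots. *)
Lemma exactly_n_simple_roots_neq0 n (p : {poly C}) :
  exactly_n_simple_roots n p -> p != 0.
Proof.
move=> [r [ur sr rr _]]; apply/eqP => p0.
have := @uniq_leq_size _ [seq i%:R : C | i <- iota 0 n.+1] r.
rewrite size_map size_iota sr ltnn => H; suff: false by []. apply: H.
- rewrite map_inj_uniq ?iota_uniq // => i j /eqP.
  by rewrite eqr_nat => /eqP.
- by move=> z _; rewrite -rr p0 root0.
Qed.

Lemma simple_root_deriv n (p : {poly C}) z :
  exactly_n_simple_roots n p -> root p z -> p^`().[z] != 0.
Proof.
move=> sp rz; have p0 := exactly_n_simple_roots_neq0 sp.
have [r [_ _ rr rm]] := sp.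
have mz : mup z p = 1%N by apply: rm; rewrite -rr.
have [q Dq] := factor_theorem _ _ rz.
rewrite Dq derivM derivXsubC mulr1 !hornerE subrr mulr0 add0r.
apply/negP => q0; have [q2 Dq2] := factor_theorem _ _ q0.
have := mup_geq z 2 p0; rewrite mz Dq Dq2 -mulrA -expr2 dvdp_mull //.
Qed.

(** The degree does not drop, since [n] distinct roots need degree [n]. *)
Lemma exactly_n_simple_roots_lead n (p : {poly C}) :
  exactly_n_simple_roots n p -> (size p <= n.+1)%N -> p`_n != 0.
Proof.
move=> sp sz; have p0 := exactly_n_simple_roots_neq0 sp.
have [r [ur sr rr _]] := sp.
have : (size r < size p)%N.
  by apply: max_poly_roots => //; apply/allP => z; rewrite -rr.
rewrite sr => nsz; have E : size p = n.+1 by apply/eqP; rewrite eqn_leq sz.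
by move: p0; rewrite -lead_coef_eq0 lead_coefE E.
Qed.

End Fibres.

(** * Isolation of continuous branches *)

Section Branches.
Variable R : realType.
Local Notation C := R[i].

Lemma continuous_cmod_sub (c : C) :
  continuous ((fun z => cmod (z - c)) : R[i]^o -> R).
Proof.
move=> z0; apply/(@cvgrPdist_lt _ _ _ _ (nbhs_filter (z0 : R[i]^o))) => e e0.
have nb : nbhs (z0 : R[i]^o) (ball (z0 : R[i]^o) (e%:C)%C).
  by apply: nbhsx_ballx; rewrite ltcR.
apply: (@filterS _ _ (nbhs_filter (z0 : R[i]^o)) _ _ _ nb) => z.
rewrite -ball_normE /ball_ /= => H.
have {}H : cmod (z0 - z) < e by rewrite -ltcR; exact: H.
apply: le_lt_trans H; rewrite ler_norml.
have h1 := cmod_sub_trans z z0 c; have h2 := cmod_sub_trans z0 z c.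
by rewrite (cmodBC z z0) in h2; apply/andP; split; lra.
Qed.

Lemma IVT_avoid (g : R -> R) (s u e : R) :
  s <= u -> {within `[s, u], continuous g} ->
  (forall t, s <= t <= u -> g t != e) -> (g s < e) = (g u < e).
Proof.
move=> su cg ne.
have gs : g s != e by apply: ne; rewrite lexx su.
have gu : g u != e by apply: ne; rewrite lexx su.
(* A value below e at one end and above at the other would force a crossing. *)
have noc : ~ (Num.min (g s) (g u) <= e <= Num.max (g s) (g u)).
  move=> /(IVT su cg)[t]; rewrite in_itv /= => tsu gt.
  by have := ne t tsu; rewrite gt eqxx.
apply/idP/idP => h; rewrite ltNge; apply/negP => h'; apply: noc.
- by rewrite ge_min le_max (ltW h) h' orbT.
- by rewrite ge_min le_max (ltW h) h' !orbT.
Qed.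

(** Two roots at the same parameter are more than [e] apart, and the circle of
    radius [e] about a root carries no root at parameters within [h].  Along a
    step of length at most [h], the distance from one branch to the starting
    value of another can then never cross [e].  Distinctness of the starting
    values is inherited from one step to the next. *)
Lemma branch_isolation n (Z : R -> C -> Prop) (y : 'I_n -> R -> C) (e h : R)
    (N : nat) :
  (0 < N)%N -> N%:R^-1 <= h -> 0 < e ->
  (forall (t : R) z z', 0 <= t <= 1 -> Z t z -> Z t z' -> z <> z' ->
     e < cmod (z' - z)) ->
  (forall (t t' : R) z z', 0 <= t <= 1 -> 0 <= t' <= 1 -> `|t - t'| <= h ->
     Z t z -> Z t' z' -> cmod (z' - z) != e) ->
  (forall k, {within `[0, 1], continuous (y k : R -> R[i]^o)}) ->
  (forall k t, 0 <= t <= 1 -> Z t (y k t)) ->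
  injective (fun k => y k 0) ->
  forall m, (m < N)%N ->
  forall t, m%:R / N%:R <= t <= m.+1%:R / N%:R -> forall k k',
    cmod (y k' t - y k (m%:R / N%:R)) < e <-> k' = k.
Proof.
move=> N0 Nh e0 sep ann cont root inj.
have N0' : 0 < N%:R :> R by rewrite ltr0n.
have part01 m : (m <= N)%N -> 0 <= (m%:R / N%:R : R) <= 1.
  by move=> mN; rewrite divr_ge0 ?ler0n //= ler_pdivrMr // mul1r ler_nat.
have step m : (m < N)%N -> injective (fun k => y k (m%:R / N%:R)) ->
    forall t, m%:R / N%:R <= t <= m.+1%:R / N%:R -> forall k k',
    cmod (y k' t - y k (m%:R / N%:R)) < e <-> k' = k.
  move=> mN injm t /andP[t1 t2] k k'.
  set s := m%:R / N%:R in t1 injm *.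
  have sub u : s <= u <= t -> 0 <= u <= 1.
    move=> /andP[su ut]; have /andP[s0 _] := part01 m (ltnW mN).
    have /andP[_ s1] := part01 m.+1 mN.
    by rewrite (le_trans s0 su) (le_trans ut (le_trans t2 s1)).
  have s01 : 0 <= s <= 1 by apply: sub; rewrite lexx t1.
  pose g u := cmod (y k' u - y k s).
  have cg : {within `[s, t], continuous g}.
    have sb : `[s, t] `<=` `[0, 1 : R].
      by move=> u /=; rewrite !in_itv /=; exact: sub.
    have cy := continuous_subspaceW sb (cont k').
    move=> u; apply: (@continuous_comp _ _ _ (y k' : subspace _ -> R[i]^o)
      (fun z => cmod (z - y k s))); first exact: cy.
    exact: continuous_cmod_sub.
  have gne u : s <= u <= t -> g u != e.
    move=> ust; have u01 := sub u ust; apply: (ann s u) => //; try exact: root.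
    case/andP: ust => su ut; rewrite distrC ger0_norm ?subr_ge0 //.
    apply: le_trans Nh; rewrite lerBlDr; apply: le_trans (le_trans ut t2) _.
    by rewrite -natr1 mulrDl mul1r addrC; exact: lexx.
  rewrite -/(g t) -(IVT_avoid t1 cg gne) /g.
  split=> [lt_e|->]; last by rewrite subrr cmod0.
  apply: contrapT => kk'; have ne : y k s <> y k' s by move/injm/esym.
  have := sep s (y k s) (y k' s) s01 (root k s s01) (root k' s s01) ne.
  by move/(lt_trans lt_e); rewrite ltxx.
have injN m : (m <= N)%N -> injective (fun k => y k (m%:R / N%:R)).
  elim: m => [_|m IHm mN]; first by rewrite mul0r.
  have tin : m%:R / N%:R <= (m.+1%:R / N%:R : R) <= m.+1%:R / N%:R.
    by rewrite lexx andbT ler_wpM2r ?invr_ge0 ?ler_nat // ltW.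
  have st := step m mN (IHm (ltnW mN)) _ tin.
  by move=> k k' /= E; apply/(st k' k); rewrite E; apply/(st k' k').
by move=> m mN; apply: step => //; apply: injN; exact: ltnW.
Qed.

End Branches.

(** * Compactness *)

Section Box.
Variable R : realType.

(** Compactness of the box enters only here; it makes the search terminate
    without giving any control on the running time. *)
Lemma box_lower_bound (h : R -> R -> R -> R) (K B : R) :
  0 <= B -> 0 <= K ->
  (forall t t' p p' q q', 0 <= t <= 1 -> 0 <= t' <= 1 ->
     `|p| <= B -> `|p'| <= B -> `|q| <= B -> `|q'| <= B ->
     `|h t p q - h t' p' q'| <= K * (`|t - t'| + `|p - p'| + `|q - q'|)) ->
  (forall t p q, 0 <= t <= 1 -> `|p| <= B -> `|q| <= B -> 0 < h t p q) ->
  exists2 mu, 0 < mu & forall t p q, 0 <= t <= 1 -> `|p| <= B -> `|q| <= B ->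
    mu <= h t p q.
Proof.
move=> B0 K0 lipK pos.
pose A : set (R * R * R) := (`[0, 1] `*` `[- B, B]) `*` `[- B, B].
have inA u : A u <-> [/\ 0 <= u.1.1 <= 1, `|u.1.2| <= B & `|u.2| <= B].
  case: u => [[t p] q]; rewrite /A /= !in_itv /= !ler_norml.
  by split=> [[[]]|[]].
have A0 : A !=set0.
  by exists (0, 0, 0); apply/inA; split; rewrite /= ?normr0 // lexx ler01.
have cA : compact A.
  by apply: compact_setX; [apply: compact_setX |]; exact: segment_compact.
pose g (u : R * R * R) := h u.1.1 u.1.2 u.2.
have cg : {within A, continuous g}.
  apply/subspace_continuousP => u /inA[u1 u2 u3].
  apply/cvgrPdist_lt => e e0; rewrite near_withinE.
  have K1 : 0 < K * 3 + 1 by lra.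
  have d0 : 0 < e / (K * 3 + 1) by rewrite divr_gt0.
  near=> v => /inA[v1 v2 v3].
  have : ball u (e / (K * 3 + 1)) v by near: v; exact: nbhsx_ballx.
  move=> [[/= b1 b2] b3]; rewrite /ball /= in b1 b2 b3.
  apply: le_lt_trans (lipK _ _ _ _ _ _ u1 v1 u2 v2 u3 v3) _.
  apply: le_lt_trans (_ : K * (3 * (e / (K * 3 + 1))) < e).
    by rewrite ler_wpM2l //; lra.
  have -> : K * (3 * (e / (K * 3 + 1))) = (K * 3) * e / (K * 3 + 1) by ring.
  by rewrite ltr_pdivrMr // mulrC ltr_pM2l //; lra.
have [c cin cmin] := compact_EVT_min A0 cA cg.
move: cin; rewrite inE => /inA[c1 c2 c3]; exists (g c); first exact: pos.
by move=> t p q ht hp hq; apply: (cmin (t, p, q)); rewrite inE; apply/inA.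
Unshelve. all: by end_near.
Qed.

End Box.

(** * The certificate *)

(** With [P] a bound on the approximate data, [dbound] bounds the exact ones;
    [rbound] bounds all roots over the edge as soon as the leading coefficient
    times [n`!] is at least [1 / (2 (P + 1))]; [radius] bounds the points of
    the square of side [2 rbound] and leaves room for rounding and for a step [1 / inv_eps]
    away from a root.  The grid has width [1 / mesh], fine enough to change
    every [dpoly] by at most half of both [1 / (P + 1)] and [1 / (D + 1)];
    [1 / inv_eps] is the isolating radius and [1 / steps] the length of the
    steps in the parameter. *)
Definition dbound (P : nat) : nat := (2 * P + 1)%N.
Definition rbound (n d P : nat) : nat :=
  (n * (d.+1 * dbound P ^ d.+1) * (2 * P.+1 * n`!) + dbound P)%N.
Definition radius (n d P : nat) : nat := (2 * rbound n d P + 2)%N.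
Definition lipc (n d P : nat) : nat := lip n d (radius n d P).
Definition mesh (n d P D : nat) : nat :=
  (lipc n d P * (2 * dbound P + 2) * (2 * P.+1 * D.+1))%N.
Definition inv_eps (n d P D : nat) : nat := (4 * lipc n d P * D.+1)%N.
Definition steps (n d P D : nat) : nat :=
  (64 * dbound P * lipc n d P ^ 2 * D.+1 ^ 2)%N.

Section Certificate.
Variable R : realType.
Local Notation C := R[i].

Lemma lip_gt0 n d b : (0 < b)%N -> (0 < lip n d b)%N.
Proof. by move=> b0; rewrite /lip !muln_gt0 fact_gt0 !expn_gt0 b0. Qed.

Lemma lipc_gt0 n d P : (0 < lipc n d P)%N.
Proof. by rewrite lip_gt0 // /radius addn_gt0 orbT. Qed.

Lemma dbound_gt0 P : (0 < dbound P)%N.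
Proof. by rewrite /dbound addn1. Qed.

Lemma mesh_gt0 n d P D : (0 < mesh n d P D)%N.
Proof.
rewrite /mesh; move: (lipc n d P) (lipc_gt0 n d P) => L L0.
by rewrite !muln_gt0 L0 addn_gt0 orbT.
Qed.

Lemma steps_gt0 n d P D : (0 < steps n d P D)%N.
Proof.
rewrite /steps; move: (lipc n d P) (lipc_gt0 n d P) (dbound_gt0 P) => L L0 A0.
by rewrite !muln_gt0 A0 L0.
Qed.

Lemma cmod_edge_path (v w : C) (t A : R) :
  0 <= t <= 1 -> cmod v <= A -> cmod w <= A -> cmod (edge_path v w t) <= A.
Proof.
move=> /andP[t0 t1] hv hw; apply: le_trans (cmodD _ _) _.
rewrite !cmodM !cmod_real ger0_norm ?subr_ge0 // ger0_norm //.
have -> : A = (1 - t) * A + t * A by ring.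
by rewrite lerD // ler_wpM2l ?subr_ge0.
Qed.

Lemma edge_path_close (v w v' w' : C) (t t' A e : R) :
  0 <= t' <= 1 -> cmod v <= A -> cmod w <= A ->
  cmod (v' - v) <= e -> cmod (w' - w) <= e ->
  cmod (edge_path v' w' t' - edge_path v w t) <= e + 2 * A * `|t' - t|.
Proof.
move=> t01 hv hw dv dw.
have -> : edge_path v' w' t' - edge_path v w t
    = edge_path (v' - v) (w' - w) t' + (t' - t)%:C%C * (w - v).
  by rewrite /edge_path !rmorphB /=; ring.
apply: le_trans (cmodD _ _) _; apply: lerD; first exact: cmod_edge_path.
rewrite cmodM cmod_real mulrC ler_wpM2r //.
by apply: le_trans (cmodD _ _) _; rewrite cmodN; lra.
Qed.

(** Primes mark the approximations that the oracle supplies. *)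
Record close_data (n d P D : nat) (a a' : nat -> nat -> C) (v w v' w' : C) :=
  CloseData {
    data_bound : [/\ forall j i, cmod (a j i) <= (dbound P)%:R,
                     cmod v <= (dbound P)%:R & cmod w <= (dbound P)%:R];
    data_bound' : [/\ forall j i, cmod (a' j i) <= (dbound P)%:R,
                      cmod v' <= (dbound P)%:R & cmod w' <= (dbound P)%:R];
    data_close : [/\ forall j i, cmod (a' j i - a j i) <= (mesh n d P D)%:R^-1,
                     cmod (v' - v) <= (mesh n d P D)%:R^-1
                   & cmod (w' - w) <= (mesh n d P D)%:R^-1] }.

Lemma dbound_le_radius n d P : (dbound P <= radius n d P)%N.
Proof.
apply: (@leq_trans (rbound n d P)); first exact: leq_addl.
by rewrite /radius mul2n -addnn -addnA leq_addr.
Qed.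

Lemma lipc_mesh n d P D :
  (lipc n d P)%:R * ((2 * (dbound P)%:R + 2) * (mesh n d P D)%:R^-1)
  = (2 * P.+1%:R * D.+1%:R)^-1 :> R.
Proof.
rewrite /mesh; move: (lipc n d P) (lipc_gt0 n d P) (dbound P) => L L0 A.
rewrite !natrM natrD natrM; field.
rewrite !nat1r -natrM -natrD !pnatr_eq0 addn2 /=.
by rewrite -lt0n.
Qed.

(** What is true at a grid point for the approximate data transfers, with this
    error, to all nearby points for the exact data, and conversely. *)
Lemma dpoly_path_close n d P D a a' v w v' w' s (t t' : R) y y' :
  close_data n d P D a a' v w v' w' ->
  0 <= t <= 1 -> 0 <= t' <= 1 -> `|t' - t| <= (mesh n d P D)%:R^-1 ->
  cmod y <= (radius n d P)%:R -> cmod y' <= (radius n d P)%:R ->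
  cmod (y' - y) <= 2 * (mesh n d P D)%:R^-1 ->
  cmod (dpoly n d s a' (edge_path v' w' t') y'
        - dpoly n d s a (edge_path v w t) y)
    <= (2 * P.+1%:R * D.+1%:R)^-1.
Proof.
move=> [[ba bv bw] [ba' bv' bw'] [da dv dw]] t01 t'01 dt hy hy' dy.
have db : (dbound P)%:R <= (radius n d P)%:R :> R.
  by rewrite ler_nat dbound_le_radius.
set A : R := (dbound P)%:R in ba bv bw ba' bv' bw' db.
set q : R := (mesh n d P D)%:R^-1 in da dv dw dt dy.
have q0 : 0 < q by rewrite invr_gt0 ltr0n mesh_gt0.
have A1 : 1 <= A by rewrite ler1n dbound_gt0.
rewrite -(lipc_mesh n d P D) -/A -/q.
have qA : 0 <= q * (A - 1) by rewrite mulr_ge0 ?subr_ge0 // ltW.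
apply: (@dpoly_lipschitz _ n d s (radius n d P)) => //.
- by rewrite /radius addn_gt0 orbT.
- by move=> j i; apply: le_trans (ba' j i) _.
- by move=> j i; apply: le_trans (ba j i) _.
- exact: le_trans (cmod_edge_path t'01 bv' bw') db.
- exact: le_trans (cmod_edge_path t01 bv bw) db.
- by move=> j i; apply: le_trans (da j i) _; lra.
- apply: le_trans (edge_path_close t t'01 bv bw dv dw) _.
  have : A * `|t' - t| <= A * q by rewrite ler_wpM2l //; lra.
  lra.
- by apply: le_trans dy _; lra.
Qed.

Lemma grid_point (x B : R) (Q : nat) : (0 < Q)%N -> `|x| <= B ->
  exists2 k : nat, k%:R <= 2 * B * Q%:R & `|k%:R / Q%:R - B - x| <= Q%:R^-1.
Proof.
move=> Q0 xB; have Q0' : 0 < Q%:R :> R by rewrite ltr0n.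
move: xB; rewrite ler_norml => /andP[x1 x2].
have p0 : 0 <= (x + B) * Q%:R by rewrite mulr_ge0 ?ler0n //; lra.
have /andP[k1 k2] := truncn_itv p0.
set k := Num.truncn _ in k1 k2; exists k.
  by apply: le_trans k1 _; rewrite ler_pM2r //; lra.
have e1 : k%:R / Q%:R <= x + B by rewrite ler_pdivrMr.
have e2 : x + B <= k%:R / Q%:R + Q%:R^-1.
  by rewrite -{2}[Q%:R^-1]mul1r -mulrDl natr1 ler_pdivlMr // ltW.
by rewrite ler_norml; apply/andP; split; lra.
Qed.

Lemma complex_grid_point (y : C) (B : R) (Q : nat) : (0 < Q)%N -> cmod y <= B ->
  exists k l : nat,
    [/\ k%:R <= 2 * B * Q%:R, l%:R <= 2 * B * Q%:R &
        cmod (Complex (k%:R / Q%:R - B) (l%:R / Q%:R - B) - y) <= 2 * Q%:R^-1].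
Proof.
case: y => p q Q0 yB.
have [k kB hk] := grid_point Q0 (le_trans (cmod_ge_re p q) yB).
have [l lB hl] := grid_point Q0 (le_trans (cmod_ge_im p q) yB).
exists k, l; split => //.
rewrite (_ : Complex _ _ - _
  = Complex (k%:R / Q%:R - B - p) (l%:R / Q%:R - B - q)) //.
by apply: le_trans (cmod_le_re_im _ _) _; lra.
Qed.

(** Only the term [j = n] survives [n] derivations. *)
Lemma dpoly_lead n d (a : nat -> nat -> C) x y :
  dpoly n d n a x y = n`!%:R * \sum_(i < d.+1) a n i * x ^+ i.
Proof.
rewrite /dpoly big_ord_recr /= big1 ?add0r => [|j _].
  rewrite mulr_sumr; apply: eq_bigr => i _.
  by rewrite ffactnn subnn expr0 mulr1.
by apply: big1 => i _; rewrite ffact_small ?ltn_ord // mul0r.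
Qed.

Lemma dpoly0E n d (a : nat -> nat -> C) x y :
  dpoly n d 0 a x y
  = \sum_(j < n.+1) (\sum_(i < d.+1) a j i * x ^+ i) * y ^+ j.
Proof.
apply: eq_bigr => j _; rewrite mulr_suml; apply: eq_bigr => i _.
by rewrite ffactn0 subn0 mul1r mulrA.
Qed.

End Certificate.

Section Soundness.
Variable R : realType.
Local Notation C := R[i].

Lemma unit_grid_point (t : R) (Q : nat) : (0 < Q)%N -> 0 <= t <= 1 ->
  exists i : nat, [/\ (i <= Q)%N, 0 <= (i%:R / Q%:R : R) <= 1 &
    `|i%:R / Q%:R - t| <= Q%:R^-1].
Proof.
move=> Q0 /andP[t0 t1]; have Q0' : 0 < Q%:R :> R by rewrite ltr0n.
have p0 : 0 <= t * Q%:R by rewrite mulr_ge0 ?ler0n.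
have /andP[k1 k2] := truncn_itv p0; set k := Num.truncn _ in k1 k2; exists k.
have kQ : (k%:R : R) <= Q%:R by apply: le_trans k1 _; rewrite ler_piMl ?ler0n.
have e1 : k%:R / Q%:R <= t by rewrite ler_pdivrMr.
have e2 : t <= k%:R / Q%:R + Q%:R^-1.
  by rewrite -{2}[Q%:R^-1]mul1r -mulrDl natr1 ler_pdivlMr // ltW.
split; first by rewrite -(ler_nat R).
- by rewrite divr_ge0 ?ler0n //= ler_pdivrMr // mul1r.
- by rewrite ler_norml; apply/andP; split; lra.
Qed.

Definition grid (n d P D k l : nat) : C :=
  Complex (k%:R / (mesh n d P D)%:R - (rbound n d P)%:R)
          (l%:R / (mesh n d P D)%:R - (rbound n d P)%:R).

(** The leading coefficient is never small, and the polynomial and its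
    derivative are never small together, on a finite grid. *)
Definition certified (n d P D : nat) (a : nat -> nat -> C) (v w : C) :=
  (forall i, (i <= mesh n d P D)%N ->
     P.+1%:R^-1
       <= cmod (dpoly n d n a (edge_path v w (i%:R / (mesh n d P D)%:R)) 0)) /\
  (forall i k l, (i <= mesh n d P D)%N ->
     (k <= 2 * rbound n d P * mesh n d P D)%N ->
     (l <= 2 * rbound n d P * mesh n d P D)%N ->
     let x := edge_path v w (i%:R / (mesh n d P D)%:R) in
     D.+1%:R^-1 <= cmod (dpoly n d 0 a x (grid n d P D k l)) \/
     D.+1%:R^-1 <= cmod (dpoly n d 1 a x (grid n d P D k l))).

Local Opaque dbound rbound radius lipc mesh inv_eps steps.

Lemma radiusE n d P : (radius n d P)%:R = 2 * (rbound n d P)%:R + 2 :> R.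
Proof. by rewrite -natrM -natrD. Qed.

Lemma rboundE n d P : (rbound n d P)%:R = (n%:R * (d.+1 * dbound P ^ d.+1)%:R)
  * (2 * P.+1%:R * n`!%:R) + (dbound P)%:R :> R.
Proof. by rewrite -!natrM -natrD. Qed.

(** The isolating radius is small enough for the quadratic term of Taylor's
    formula to eat only half of a derivative of size [1 / (2 (D + 1))]. *)
Lemma inv_eps_lipc n d P D :
  (lipc n d P)%:R * (inv_eps n d P D)%:R^-1 = 4^-1 * D.+1%:R^-1 :> R.
Proof.
have -> : inv_eps n d P D = (4 * lipc n d P * D.+1)%N by [].
move: (lipc n d P) (lipc_gt0 n d P) => L L0; rewrite !natrM; field.
by rewrite nat1r !pnatr_eq0 /= -lt0n.
Qed.

(** Along one step the polynomial moves by less than the lower bound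
    [certified_lower] on the circle of radius [1 / inv_eps]. *)
Lemma steps_lipc n d P D :
  (lipc n d P)%:R * (2 * (dbound P)%:R * (steps n d P D)%:R^-1)
  < 4^-1 * D.+1%:R^-1 * (inv_eps n d P D)%:R^-1 :> R.
Proof.
have -> : inv_eps n d P D = (4 * lipc n d P * D.+1)%N by [].
have -> : steps n d P D = (64 * dbound P * lipc n d P ^ 2 * D.+1 ^ 2)%N by [].
move: (lipc n d P) (lipc_gt0 n d P) (dbound P) (dbound_gt0 P) => L L0 A A0.
have L0' : 0 < L%:R :> R by rewrite ltr0n.
have A0' : 0 < A%:R :> R by rewrite ltr0n.
have D0 : 0 < D.+1%:R :> R by rewrite ltr0n.
rewrite !natrM; move: (L%:R : R) (A%:R : R) (D.+1%:R : R) L0' A0' D0.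
move=> l b e l0 b0 e0.
have -> : l * (2 * b * (64 * b * (l * l) * (e * e))^-1)
  = 2^-1 * (16 * l * e ^+ 2)^-1.
  by field; rewrite !gt_eqF.
have -> : 4^-1 * e^-1 * (4 * l * e)^-1 = (16 * l * e ^+ 2)^-1.
  by field; rewrite !gt_eqF.
have : 0 < (16 * l * e ^+ 2)^-1 by rewrite invr_gt0 !mulr_gt0 ?exprn_gt0.
by move: (_^-1) => r; lra.
Qed.

Lemma inv_eps_gt0 n d P D : (0 < inv_eps n d P D)%N.
Proof.
have -> : inv_eps n d P D = (4 * lipc n d P * D.+1)%N by [].
by move: (lipc n d P) (lipc_gt0 n d P) => L L0; rewrite !muln_gt0 L0.
Qed.

Lemma err_le_P P D : (2 * P.+1%:R * D.+1%:R)^-1 <= 2^-1 * P.+1%:R^-1 :> R.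
Proof.
rewrite !invfM ler_piMr ?mulr_ge0 ?invr_ge0 ?ler0n //.
by rewrite invf_le1 ?ltr0n // ler1n.
Qed.

Lemma err_le_D P D : (2 * P.+1%:R * D.+1%:R)^-1 <= 2^-1 * D.+1%:R^-1 :> R.
Proof.
rewrite mulrAC !invfM ler_piMr ?mulr_ge0 ?invr_ge0 ?ler0n //.
by rewrite invf_le1 ?ltr0n // ler1n.
Qed.

Section Certified.
Variables (n d P D : nat) (a a' : nat -> nat -> C) (v w v' w' : C).
Hypothesis close : close_data n d P D a a' v w v' w'.
Hypothesis cert : certified n d P D a' v' w'.

Lemma certified_lead (t : R) : 0 <= t <= 1 ->
  2^-1 * P.+1%:R^-1 <= cmod (dpoly n d n a (edge_path v w t) 0).
Proof.
move=> t01; have [i [iQ i01 it]] := unit_grid_point (mesh_gt0 n d P D) t01.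
have h0 : cmod (0 : C) <= (radius n d P)%:R by rewrite cmod0 ler0n.
have hq : cmod (0 - 0 : C) <= 2 * (mesh n d P D)%:R^-1.
  by rewrite subrr cmod0 mulr_ge0 ?invr_ge0 ?ler0n.
have := le_trans (dpoly_path_close n close t01 i01 it h0 h0 hq) (err_le_P P D).
have := cert.1 i iQ; set u := dpoly _ _ _ _ _ _; set u' := dpoly _ _ _ _ _ _.
have := cmod_le_sub u u'.
by move: (P.+1%:R^-1 : R) => p; lra.
Qed.

(** The lower bound on the leading coefficient confines all roots to the
    region that the grid covers. *)
Lemma certified_root_bound (t : R) y : 0 <= t <= 1 ->
  dpoly n d 0 a (edge_path v w t) y = 0 -> cmod y <= (rbound n d P)%:R.
Proof.
move=> t01; rewrite dpoly0E; set x := edge_path v w t.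
have [[ba bv bw] _ _] := close.
have bx : cmod x <= (dbound P)%:R by exact: cmod_edge_path.
have A1 : 1 <= (dbound P)%:R :> R by rewrite ler1n dbound_gt0.
have n0 : 0 < n`!%:R :> R by rewrite ltr0n fact_gt0.
have p0 : 0 < P.+1%:R :> R by rewrite ltr0n.
apply: (@root_bound _ n (fun j => \sum_(i < d.+1) a j i * x ^+ i) y
  (d.+1 * dbound P ^ d.+1)%:R (2 * P.+1%:R * n`!%:R)^-1).
- move=> j _; apply: le_trans (cmod_sum _) _.
  have -> : (d.+1 * dbound P ^ d.+1)%:R = \sum_(i < d.+1) (dbound P ^ d.+1)%:R :> R.
    by rewrite sumr_const card_ord natrM mulr_natl.
  apply: ler_sum => i _; rewrite cmodM expnS natrM.
  apply: ler_pM; rewrite ?cmod_ge0 //; apply: le_trans (cmodX_le i bx) _.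
  by rewrite natrX ler_weXn2l // -ltnS ltn_ord.
- have := certified_lead t01; rewrite dpoly_lead cmodM cmod_nat -/x.
  rewrite !invfM => H; rewrite -(ler_pM2l n0); apply: le_trans H.
  by rewrite mulrCA mulfV ?mulr1 ?gt_eqF.
- by rewrite invr_gt0 !mulr_gt0.
- rewrite rboundE; apply: le_trans A1 _.
  by rewrite lerDr !mulr_ge0 ?ler0n.
- rewrite ler_pdivlMr ?mulr_gt0 // rboundE.
  by rewrite lerDl ler0n.
Qed.

(** At a root the first alternative of the certificate is impossible at the
    nearest grid point, so the second one holds there. *)
Lemma certified_deriv (t : R) y : 0 <= t <= 1 ->
  dpoly n d 0 a (edge_path v w t) y = 0 ->
  2^-1 * D.+1%:R^-1 <= cmod (dpoly n d 1 a (edge_path v w t) y).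
Proof.
move=> t01 y0; have yB := certified_root_bound t01 y0.
have [i [iQ i01 it]] := unit_grid_point (mesh_gt0 n d P D) t01.
have [k [l [kB lB kl]]] := complex_grid_point (mesh_gt0 n d P D) yB.
rewrite -/(grid n d P D k l) in kl.
have q1 : (mesh n d P D)%:R^-1 <= 1 :> R.
  by rewrite invf_le1 ?ltr0n ?mesh_gt0 // ler1n mesh_gt0.
have B0 : 0 <= (rbound n d P)%:R :> R by rewrite ler0n.
have hy : cmod y <= (radius n d P)%:R by rewrite radiusE; lra.
have hg : cmod (grid n d P D k l) <= (radius n d P)%:R.
  by rewrite radiusE; have := cmod_le_sub (grid n d P D k l) y; lra.
have kB' : (k <= 2 * rbound n d P * mesh n d P D)%N.
  by rewrite -(ler_nat R) natrM natrM.
have lB' : (l <= 2 * rbound n d P * mesh n d P D)%N.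
  by rewrite -(ler_nat R) natrM natrM.
have D0 : 0 < D.+1%:R^-1 :> R by rewrite invr_gt0 ltr0n.
case: (cert.2 i k l iQ kB' lB') => H.
- have := le_trans (dpoly_path_close 0 close t01 i01 it hy hg kl) (err_le_D P D).
  by rewrite y0 subr0; move: (D.+1%:R^-1 : R) D0 H => p; lra.
- have := le_trans (dpoly_path_close 1 close t01 i01 it hy hg kl) (err_le_D P D).
  move: H; set u' := dpoly _ _ _ _ _ _; set u := dpoly _ _ _ _ _ _.
  by have := cmod_le_sub u' u; move: (D.+1%:R^-1 : R) => p; lra.
Qed.

(** Near a root [z] the linear term [F_y(z) (y - z)] dominates. *)
Lemma certified_lower (t : R) y z : 0 <= t <= 1 ->
  dpoly n d 0 a (edge_path v w t) z = 0 ->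
  cmod (y - z) <= (inv_eps n d P D)%:R^-1 ->
  4^-1 * D.+1%:R^-1 * cmod (y - z)
    <= cmod (dpoly n d 0 a (edge_path v w t) y).
Proof.
move=> t01 z0 hyz; have zB := certified_root_bound t01 z0.
have dz := certified_deriv t01 z0.
have [[ba bv bw] _ _] := close.
have L0 : 0 < (lipc n d P)%:R :> R by rewrite ltr0n lipc_gt0.
have eps1 : (inv_eps n d P D)%:R^-1 <= 1 :> R.
  by rewrite invf_le1 ?ltr0n ?ler1n ?inv_eps_gt0.
have B0 : 0 <= (rbound n d P)%:R :> R by rewrite ler0n.
have hz : cmod z <= (radius n d P)%:R by rewrite radiusE; lra.
have hy : cmod y <= (radius n d P)%:R.
  by rewrite radiusE; have := cmod_le_sub y z; lra.
have db : (dbound P)%:R <= (radius n d P)%:R :> R.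
  by rewrite ler_nat dbound_le_radius.
have hx : cmod (edge_path v w t) <= (radius n d P)%:R.
  exact: le_trans (cmod_edge_path t01 bv bw) db.
have rad0 : (0 < radius n d P)%N.
  by apply: leq_trans (dbound_le_radius n d P); exact: dbound_gt0.
have ha j i : cmod (a j i) <= (radius n d P)%:R by exact: le_trans (ba j i) db.
have := dpoly_taylor n d rad0 ha hx hy hz; rewrite -/(lipc n d P) z0 subr0.
set u := dpoly n d 0 a _ y; set u1 := dpoly n d 1 a _ z => T.
have r0 := cmod_ge0 (y - z); set r := cmod (y - z) in hyz T r0 *.
have h1 : (lipc n d P)%:R * r ^+ 2 <= 4^-1 * D.+1%:R^-1 * r.
  by rewrite -(inv_eps_lipc n d P D) expr2 mulrA ler_wpM2r // ler_wpM2l // ltW.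
have h2 : 2^-1 * D.+1%:R^-1 * r <= cmod (u1 * (y - z)).
  by rewrite cmodM ler_wpM2r.
have h3 := cmod_le_sub (u1 * (y - z)) u; rewrite (cmodBC _ u) in h3.
move: h2 h3 (le_trans T h1); move: (D.+1%:R^-1 : R) => p; lra.
Qed.

Lemma certified_separation (t : R) z z' : 0 <= t <= 1 ->
  dpoly n d 0 a (edge_path v w t) z = 0 ->
  dpoly n d 0 a (edge_path v w t) z' = 0 -> z <> z' ->
  (inv_eps n d P D)%:R^-1 < cmod (z' - z).
Proof.
move=> t01 z0 z'0 ne; rewrite ltNge; apply/negP => le.
have := certified_lower t01 z0 le; rewrite z'0 cmod0.
apply/negP; rewrite -ltNge !mulr_gt0 ?invr_gt0 ?ltr0n //.
by rewrite cmod_gt0 subr_eq0; apply/eqP => /esym.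
Qed.

(** A root at distance exactly [1 / inv_eps] is excluded at the parameter [t] by
    [certified_lower], and at [t'] because the polynomial has hardly moved. *)
Lemma certified_annulus (t t' : R) z z' : 0 <= t <= 1 -> 0 <= t' <= 1 ->
  `|t - t'| <= (steps n d P D)%:R^-1 ->
  dpoly n d 0 a (edge_path v w t) z = 0 ->
  dpoly n d 0 a (edge_path v w t') z' = 0 ->
  cmod (z' - z) != (inv_eps n d P D)%:R^-1.
Proof.
move=> t01 t'01 tt' z0 z'0; apply/eqP => E.
have le : cmod (z' - z) <= (inv_eps n d P D)%:R^-1 by rewrite E.
have low := certified_lower t01 z0 le; rewrite E in low.
have [[ba bv bw] _ _] := close.
have db : (dbound P)%:R <= (radius n d P)%:R :> R.
  by rewrite ler_nat dbound_le_radius.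
have rad0 : (0 < radius n d P)%N.
  by apply: leq_trans (dbound_le_radius n d P); exact: dbound_gt0.
have hz' : cmod z' <= (radius n d P)%:R.
  apply: le_trans (certified_root_bound t'01 z'0) _.
  by rewrite radiusE; have := ler0n R (rbound n d P); lra.
have e0 : 0 <= 2 * (dbound P)%:R * `|t - t'| by rewrite !mulr_ge0.
have ha j i : cmod (a j i) <= (radius n d P)%:R by exact: le_trans (ba j i) db.
have hx u : 0 <= u <= 1 -> cmod (edge_path v w u) <= (radius n d P)%:R.
  by move=> u01; exact: le_trans (cmod_edge_path u01 bv bw) db.
have path : cmod (edge_path v w t - edge_path v w t')
    <= 0 + 2 * (dbound P)%:R * `|t - t'|.
  by apply: edge_path_close; rewrite ?subrr ?cmod0.
rewrite add0r in path.
have H : cmod (dpoly n d 0 a (edge_path v w t) z'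
    - dpoly n d 0 a (edge_path v w t') z')
  <= (lipc n d P)%:R * (2 * (dbound P)%:R * `|t - t'|).
  apply: dpoly_lipschitz => //; rewrite ?subrr ?cmod0 ?hx //.
  by move=> j i; rewrite subrr cmod0.
rewrite z'0 subr0 in H; have := le_lt_trans (le_trans low H) _.
move=> /(_ (4^-1 * D.+1%:R^-1 * (inv_eps n d P D)%:R^-1)).
rewrite ltxx => F; suff: false by []; apply: F.
apply: le_lt_trans (steps_lipc n d P D); rewrite ler_wpM2l ?ler0n //.
by rewrite ler_wpM2l // mulr_ge0 ?ler0n.
Qed.

End Certified.
End Soundness.

(** * The program *)

Definition coef_code (o : nat -> nat) (q j i : nat) : nat :=
  o (npair (npair i j).+2 q).

Definition path_code (o : nat -> nat) (q t : nat) : nat :=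
  gadd (o (npair 0 q)) (gmul t (gadd (o (npair 1 q)) (gopp (o (npair 0 q))))).

Definition dpoly_code (o : nat -> nat) (q n d s x y : nat) : nat :=
  gsum (fun j => gsum (fun i => gmul (gfrac (j ^_ s) 0)
    (gmul (coef_code o q j i) (gmul (gpow x i) (gpow y (j - s))))) d.+1) n.+1.

(** One coordinate of [grid]. *)
Definition grid_coord_code (Q B p : nat) : nat :=
  qadd (qfrac p Q.-1) (qopp (qfrac B 0)).

Definition grid_code (Q B k l : nat) : nat :=
  npair (grid_coord_code Q B k) (grid_coord_code Q B l).

Definition data_test (o : nat -> nat) (n d P Q : nat) : bool :=
  all_below (fun j => all_below (fun i => gbounded P (coef_code o Q j i)) d.+1)
    n.+1 && (gbounded P (o (npair 0 Q)) && gbounded P (o (npair 1 Q))).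

Definition lead_test (o : nat -> nat) (n d P Q : nat) : bool :=
  all_below (fun i => glarge P
    (dpoly_code o Q n d n (path_code o Q (gfrac i Q.-1)) (gfrac 0 0))) Q.+1.

Definition grid_test (o : nat -> nat) (n d D Q B : nat) : bool :=
  all_below (fun i => all_below (fun k => all_below (fun l =>
    glarge D (dpoly_code o Q n d 0 (path_code o Q (gfrac i Q.-1))
                (grid_code Q B k l))
    || glarge D (dpoly_code o Q n d 1 (path_code o Q (gfrac i Q.-1))
                   (grid_code Q B k l)))
    (2 * B * Q).+1) (2 * B * Q).+1) Q.+1.

Definition test (o : nat -> nat) (n d P D : nat) : bool :=
  data_test o n d P (mesh n d P D) &&
  (lead_test o n d P (mesh n d P D) &&
   grid_test o n d D (mesh n d P D) (rbound n d P)).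

Definition subdivision_code (N E : nat) : nat :=
  npair (seq_code (mkseq (fun i => qfrac i N.-1) N.+1))
        (seq_code (mkseq (fun=> qfrac 1 E.-1) N)).

Lemma computable_dpoly_code Q N D S X Y :
  computable Q -> computable N -> computable D -> computable S ->
  computable X -> computable Y ->
  computable (fun o a =>
    dpoly_code o (Q o a) (N o a) (D o a) (S o a) (X o a) (Y o a)).
Proof. by move=> *; rewrite /dpoly_code /coef_code; computability. Qed.

Lemma computable_path_code Q T : computable Q -> computable T ->
  computable (fun o a => path_code o (Q o a) (T o a)).
Proof. by move=> *; rewrite /path_code; computability. Qed.

Lemma computable_grid_code Q B K L :
  computable Q -> computable B -> computable K -> computable L ->
  computable (fun o a => grid_code (Q o a) (B o a) (K o a) (L o a)).
Proof.
by move=> *; rewrite /grid_code /grid_coord_code /qadd /qopp; computability.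
Qed.

Hint Resolve computable_dpoly_code computable_path_code computable_grid_code
  : computability.

Lemma computable_data_test N D P Q :
  computable N -> computable D -> computable P -> computable Q ->
  computable (fun o a => data_test o (N o a) (D o a) (P o a) (Q o a) : nat).
Proof. by move=> *; rewrite /data_test /coef_code; computability. Qed.

Lemma computable_lead_test N D P Q :
  computable N -> computable D -> computable P -> computable Q ->
  computable (fun o a => lead_test o (N o a) (D o a) (P o a) (Q o a) : nat).
Proof. by move=> *; rewrite /lead_test; computability. Qed.

Lemma computable_grid_test N D E Q B :
  computable N -> computable D -> computable E -> computable Q -> computable B ->
  computable (fun o a => grid_test o (N o a) (D o a) (E o a) (Q o a) (B o a) : nat).
Proof. by move=> *; rewrite /grid_test; computability. Qed.

Lemma computable_rbound N D P :
  computable N -> computable D -> computable P ->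
  computable (fun o a => rbound (N o a) (D o a) (P o a)).
Proof. by move=> *; rewrite /rbound /dbound; computability. Qed.

Lemma computable_lipc N D P :
  computable N -> computable D -> computable P ->
  computable (fun o a => lipc (N o a) (D o a) (P o a)).
Proof.
move=> NC DC PC; have BC := computable_rbound NC DC PC.
by rewrite /lipc /lip /radius; computability.
Qed.

Hint Resolve computable_data_test computable_lead_test computable_grid_test
  computable_rbound computable_lipc : computability.

Lemma computable_test N D P E :
  computable N -> computable D -> computable P -> computable E ->
  computable (fun o a => test o (N o a) (D o a) (P o a) (E o a) : nat).
Proof.
move=> NC DC PC EC; have QC : computable
    (fun o a => mesh (N o a) (D o a) (P o a) (E o a)).
  by rewrite /mesh /dbound; computability.
by rewrite /test; computability.
Qed.

Lemma computable_subdivision_code F G : computable F -> computable G ->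
  computable (fun o a => subdivision_code (F o a) (G o a)).
Proof. by move=> *; rewrite /subdivision_code; computability. Qed.

Hint Resolve computable_test computable_subdivision_code : computability.

Definition output_code (n d m : nat) : nat :=
  subdivision_code (steps n d (pfst m) (psnd m)) (inv_eps n d (pfst m) (psnd m)).

(** The search variable codes the pair of [P] and [D]; everything else is an
    explicit function of that pair and the degrees. *)
Lemma isolation_program : exists prog : code,
  forall o n d, (exists P D, test o n d P D) ->
  exists P D, test o n d P D /\
    Defs.eval o prog (npair n d)
      (subdivision_code (steps n d P D) (inv_eps n d P D)).
Proof.
have [|c Hc] := @search_program (fun o a m =>
  test o (pfst a) (psnd a) (pfst m) (psnd m)); first by computability.
have [c' Hc'] : computable (fun _ e =>
    output_code (pfst (pfst e)) (psnd (pfst e)) (psnd e)).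
  rewrite /output_code; apply: computable_subdivision_code;
  by rewrite /steps /inv_eps /dbound; computability.
have [id Hid] := computable_id.
exists (Comp c' (Pair id c)) => o n d [P [D PD]].
have [|m Tm em] := Hc o (npair n d).
  by exists (npair P D); rewrite !pairE.
rewrite !pairE in Tm; exists (pfst m), (psnd m); split=> //.
apply: eval_comp (eval_pair (Hid o _) em) _.
by have := Hc' o (npair (npair n d) m); rewrite !pairE.
Qed.

Section ProgramValues.
Variable R : realType.
Local Notation C := R[i].

Lemma gval_path_code o q t (r : R) : gval R t = r%:C%C ->
  gval R (path_code o q t)
  = edge_path (gval R (o (npair 0 q))) (gval R (o (npair 1 q))) r.
Proof.
move=> tE; rewrite /path_code /edge_path.
rewrite !(gval_add, gval_mul, gval_opp) tE rmorphB /=; ring.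
Qed.

Lemma gval_dpoly_code o q n d s x y :
  gval R (dpoly_code o q n d s x y)
  = dpoly n d s (fun j i => gval R (coef_code o q j i)) (gval R x) (gval R y).
Proof.
rewrite /dpoly_code gval_sum; apply: eq_bigr => j _.
rewrite gval_sum; apply: eq_bigr => i _.
rewrite !gval_mul !gval_pow gval_frac divr1.
by rewrite -[((_ ^_ _)%:R)%:C%C]/((real_complex R) _) rmorph_nat.
Qed.

Lemma gval_gfrac_pred i Q : (0 < Q)%N ->
  gval R (gfrac i Q.-1) = (i%:R / Q%:R)%:C%C.
Proof. by move=> Q0; rewrite gval_frac prednK. Qed.

Lemma gval_grid_code n d P D k l :
  gval R (grid_code (mesh n d P D) (rbound n d P) k l) = grid R n d P D k l.
Proof.
rewrite /gval /grid_code /grid_coord_code !pairE !qval_add !qval_opp !qval_frac.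
by rewrite !divr1 prednK ?mesh_gt0.
Qed.

Lemma gval_0 : gval R (gfrac 0 0) = 0.
Proof. by rewrite gval_frac mul0r. Qed.

End ProgramValues.

(** * Correctness and termination of the search *)

Section Search.
Variable R : realType.
Local Notation C := R[i].

Local Opaque dbound rbound radius lipc mesh inv_eps steps.

Definition data_name (o : nat -> nat) (a : nat -> nat -> C) (v w : C) :=
  [/\ forall j i q, cmod (gval R (coef_code o q j i) - a j i) <= 2 ^- q,
      forall q, cmod (gval R (o (npair 0 q)) - v) <= 2 ^- q
    & forall q, cmod (gval R (o (npair 1 q)) - w) <= 2 ^- q].

Lemma names_data_name o f v w : names o (@edge_data R f v w) ->
  data_name o (fun j i => f`_j`_i) v w.
Proof.
move=> no.
have H k q : cmod (gval R (o (npair k q)) - edge_data f v w k) <= 2 ^- q.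
  move: (no k q); rewrite /gval -!ratr_rat_of_code /pfst /psnd.
  by case: (Cantor.of_nat _).
split=> [j i q|q|q]; [|exact: (H 0%N)|exact: (H 1%N)].
have := H (npair i j).+2 q; rewrite /coef_code /edge_data.
by rewrite /npair Cantor.cancel_of_to.
Qed.

Variables (o : nat -> nat) (n d : nat) (a : nat -> nat -> C) (v w : C).
Hypothesis name : data_name o a v w.
Hypothesis supp : forall j i, ~~ ((j <= n)%N && (i <= d)%N) -> a j i = 0.

Let approx (q j i : nat) : C := gval R (coef_code o q j i).

Lemma name_mesh Q : (0 < Q)%N -> 2 ^- Q <= Q%:R^-1 :> R.
Proof.
move=> Q0; rewrite lef_pV2 ?posrE ?ltr0n ?exprn_gt0 //.
by rewrite -natrX ler_nat ltnW // ltn_expl.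
Qed.

(** Coefficients outside the tested range vanish, so that their approximations
    have modulus at most 1. *)
Lemma data_test_close P D : data_test o n d P (mesh n d P D) ->
  close_data n d P D a (approx (mesh n d P D)) v w
    (gval R (o (npair 0 (mesh n d P D)))) (gval R (o (npair 1 (mesh n d P D)))).
Proof.
move: (mesh_gt0 n d P D) => Q0; have [na nv nw] := name.
have Q1 : (mesh n d P D)%:R^-1 <= 1 :> R by rewrite invf_le1 ?ltr0n // ler1n.
have AE : (dbound P)%:R = 2 * P%:R + 1 :> R.
  have -> : dbound P = (2 * P + 1)%N by [].
  by rewrite natrD natrM.
have eQ := name_mesh Q0.
move=> /andP[/all_belowP ta /andP[/(gbounded_cmod R) tv /(gbounded_cmod R) tw]].
have {}ta j i : (j <= n)%N -> (i <= d)%N ->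
    cmod (approx (mesh n d P D) j i) <= P%:R *+ 2.
  by move=> jn id; apply: gbounded_cmod; have /all_belowP := ta j jn; apply.
have A0 : 1 <= (dbound P)%:R :> R by rewrite ler1n dbound_gt0.
have da j i := le_trans (na j i (mesh n d P D)) eQ.
have dv := le_trans (nv (mesh n d P D)) eQ.
have dw := le_trans (nw (mesh n d P D)) eQ.
have da1 j i := le_trans (da j i) Q1.
have dv1 := le_trans dv Q1; have dw1 := le_trans dw Q1.
have ba' j i : cmod (approx (mesh n d P D) j i) <= (dbound P)%:R.
  have [/andP[jn id]|out] := boolP ((j <= n)%N && (i <= d)%N).
    by apply: le_trans (ta j i jn id) _; rewrite AE -mulr_natl lerDl.
  by have := da1 j i; rewrite supp // subr0 => h; exact: le_trans h A0.
have ba j i : cmod (a j i) <= (dbound P)%:R.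
  have [/andP[jn id]|out] := boolP ((j <= n)%N && (i <= d)%N); last first.
    by rewrite supp // cmod0 ler0n.
  have := cmod_le_sub (a j i) (approx (mesh n d P D) j i).
  by rewrite cmodBC AE; have := ta j i jn id; have := da1 j i; lra.
split; split => //.
- have := cmod_le_sub v (gval R (o (npair 0 (mesh n d P D)))).
  by rewrite cmodBC AE; move: tv tw dv1 dw1; lra.
- have := cmod_le_sub w (gval R (o (npair 1 (mesh n d P D)))).
  by rewrite cmodBC AE; move: tv tw dv1 dw1; lra.
- by apply: le_trans tv _; rewrite AE -mulr_natl lerDl.
- by apply: le_trans tw _; rewrite AE -mulr_natl lerDl.
Qed.

Lemma test_certified P D : test o n d P D ->
  certified n d P D (approx (mesh n d P D))
    (gval R (o (npair 0 (mesh n d P D)))) (gval R (o (npair 1 (mesh n d P D)))).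
Proof.
move=> /and3P[_ /all_belowP tl /all_belowP tg]; split=> [i iQ|i k l iQ kB lB x].
  have /glarge_lower - /(_ R) := tl i iQ.
  by rewrite gval_dpoly_code gval_0
    (gval_path_code _ _ (gval_gfrac_pred R i (mesh_gt0 _ _ _ _))).
have /all_belowP/(_ k kB)/all_belowP/(_ l lB) := tg i iQ.
move=> /orP[] /glarge_lower - /(_ R);
  rewrite gval_dpoly_code gval_grid_code
    (gval_path_code _ _ (gval_gfrac_pred R i (mesh_gt0 _ _ _ _))); by [left|right].
Qed.

Lemma data_bound_exists : exists W : nat,
  [/\ forall j i, cmod (a j i) <= W%:R, cmod v <= W%:R & cmod w <= W%:R].
Proof.
pose S := \sum_(j < n.+1) \sum_(i < d.+1) cmod (a j i).
have S0 : 0 <= S by apply: sumr_ge0 => j _; apply: sumr_ge0 => i _; exact: cmod_ge0.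
have aS j i : cmod (a j i) <= S.
  have [/andP[jn id]|out] := boolP ((j <= n)%N && (i <= d)%N); last first.
    by rewrite supp // cmod0.
  rewrite -ltnS in jn; rewrite -ltnS in id.
  rewrite /S (bigD1 (Ordinal jn)) //= (bigD1 (Ordinal id)) //= -addrA lerDl.
  rewrite addr_ge0 ?sumr_ge0 // => k _; rewrite ?sumr_ge0 // => *;
  exact: cmod_ge0.
have v0 := cmod_ge0 v; have w0 := cmod_ge0 w.
have := truncnS_gt (S + cmod v + cmod w); set W := (Num.truncn _).+1 => HW.
by exists W; split=> [j i||]; try have := aS j i; lra.
Qed.

Lemma cmod_sub_cmod (x y : C) : `|cmod x - cmod y| <= cmod (x - y).
Proof.
have := cmod_le_sub x y; have := cmod_le_sub y x; rewrite (cmodBC y x).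
by rewrite ler_norml => h1 h2; apply/andP; split; lra.
Qed.

(** The real coordinates [p], [q] of [y] make the domain a box. *)
Lemma dpoly_box_bound s s' (B : nat) :
  (forall (t p q : R), 0 <= t <= 1 -> `|p| <= B%:R -> `|q| <= B%:R ->
     0 < cmod (dpoly n d s a (edge_path v w t) (Complex p q))
         + cmod (dpoly n d s' a (edge_path v w t) (Complex p q))) ->
  exists2 mu : R, 0 < mu & forall (t p q : R),
    0 <= t <= 1 -> `|p| <= B%:R -> `|q| <= B%:R ->
     mu <= cmod (dpoly n d s a (edge_path v w t) (Complex p q))
         + cmod (dpoly n d s' a (edge_path v w t) (Complex p q)).
Proof.
move=> pos; have [W [ba bv bw]] := data_bound_exists.
pose b := (W + 2 * B).+1; pose L : R := (lip n d b)%:R.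
have bE : b%:R = W%:R + 2 * B%:R + 1 :> R by rewrite /b -natr1 natrD natrM.
have W0 : 0 <= W%:R :> R by rewrite ler0n.
have B0 : 0 <= B%:R :> R by rewrite ler0n.
have Wb : W%:R <= b%:R :> R by rewrite bE; lra.
have hx t : 0 <= t <= 1 -> cmod (edge_path v w t) <= b%:R.
  move=> t01; apply: cmod_edge_path => //; first exact: le_trans bv Wb.
  exact: le_trans bw Wb.
have hy (p q : R) : `|p| <= B%:R -> `|q| <= B%:R -> cmod (Complex p q) <= b%:R.
  by move=> hp hq; apply: le_trans (cmod_le_re_im _ _) _; rewrite bE; lra.
have lipS k (t t' p p' q q' : R) : 0 <= t <= 1 -> 0 <= t' <= 1 ->
    `|p| <= B%:R -> `|p'| <= B%:R -> `|q| <= B%:R -> `|q'| <= B%:R ->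
    `|cmod (dpoly n d k a (edge_path v w t) (Complex p q))
      - cmod (dpoly n d k a (edge_path v w t') (Complex p' q'))|
    <= L * (2 * b%:R * (`|t - t'| + `|p - p'| + `|q - q'|)).
  move=> t01 t'01 p1 p2 q1 q2; apply: le_trans (cmod_sub_cmod _ _) _.
  have b1 : 1 <= b%:R :> R by rewrite ler1n.
  have tn := normr_ge0 (t - t'); have pn := normr_ge0 (p - p').
  have qn := normr_ge0 (q - q').
  have e0 : 0 <= (b%:R - 1) * (`|p - p'| + `|q - q'|).
    by apply: mulr_ge0; rewrite ?subr_ge0 ?addr_ge0.
  have e1 : 0 <= b%:R * `|t - t'| by rewrite mulr_ge0.
  have ab j i : cmod (a j i) <= b%:R by exact: le_trans (ba j i) Wb.
  apply: dpoly_lipschitz => //; rewrite ?hx ?hy //.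
  - by move=> j i; rewrite subrr cmod0; lra.
  - have := @edge_path_close R v w v w t' t b%:R 0 t01
      (le_trans bv Wb) (le_trans bw Wb).
    by rewrite !subrr cmod0 => /(_ (lexx 0) (lexx 0)); lra.
  - rewrite (_ : _ - _ = Complex (p - p') (q - q')) //.
    by apply: le_trans (cmod_le_re_im _ _) _; lra.
pose h (t p q : R) := cmod (dpoly n d s a (edge_path v w t) (Complex p q))
   + cmod (dpoly n d s' a (edge_path v w t) (Complex p q)).
apply: (@box_lower_bound R h (4 * L * b%:R) B%:R) => //.
  by rewrite !mulr_ge0 ?ler0n.
move=> t t' p p' q q' t01 t'01 p1 p2 q1 q2; rewrite /h.
have h1 := lipS s _ _ _ _ _ _ t01 t'01 p1 p2 q1 q2.
have h2 := lipS s' _ _ _ _ _ _ t01 t'01 p1 p2 q1 q2.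
rewrite opprD addrACA; apply: le_trans (ler_normD _ _) _.
apply: le_trans (lerD h1 h2) _; rewrite le_eqVlt; apply/orP; left; apply/eqP; ring.
Qed.

Lemma pow2_le1 q : 2 ^- q <= 1 :> R.
Proof. by rewrite invf_le1 ?exprn_gt0 // exprn_ege1 // ler1n. Qed.

(** With a factor 6, one of two quantities of sum at least [mu] is at least
    [3 / (k + 1)], which after rounding still exceeds the threshold of
    [glarge_upper]. *)
Lemma recip_small (mu : R) : 0 < mu -> exists k : nat, 6 * k.+1%:R^-1 <= mu.
Proof.
move=> mu0; exists (Num.truncn (6 / mu)).
by rewrite ler_pdivrMr ?ltr0n // mulrC -ler_pdivrMr // ltW // truncnS_gt.
Qed.

Lemma large_approx (u u' : C) (e : R) :
  0 <= e -> 3 * e <= cmod u -> cmod (u' - u) <= 2^-1 * e -> 2 * e <= cmod u'.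
Proof. by move=> e0; have := cmod_le_sub u u'; rewrite (cmodBC u); lra. Qed.

Lemma dpoly_lead_indep (x y : C) : dpoly n d n a x y = dpoly n d n a x 0.
Proof. by rewrite !dpoly_lead. Qed.

(** [P] is fixed first, from the size of the data and the minimum of the
    leading coefficient; it determines the region of the grid, and [D] then
    comes from the minimum over that region. *)
Lemma test_complete :
  (forall t : R, 0 <= t <= 1 -> dpoly n d n a (edge_path v w t) 0 != 0) ->
  (forall (t : R) y, 0 <= t <= 1 -> dpoly n d 0 a (edge_path v w t) y = 0 ->
     dpoly n d 1 a (edge_path v w t) y != 0) ->
  exists P D, test o n d P D.
Proof.
move=> lead simple; have [W [ba bv bw]] := data_bound_exists.
have Wa q j i : cmod (approx q j i) <= W%:R + 1.
  have [na _ _] := name; have := cmod_le_sub (approx q j i) (a j i).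
  have := le_trans (na j i q) (pow2_le1 q).
  by have := ba j i; rewrite /approx; lra.
have Wv q : cmod (gval R (o (npair 0 q))) <= W%:R + 1.
  have [_ nv _] := name; have := cmod_le_sub (gval R (o (npair 0 q))) v.
  by have := le_trans (nv q) (pow2_le1 q); lra.
have Ww q : cmod (gval R (o (npair 1 q))) <= W%:R + 1.
  have [_ _ nw] := name; have := cmod_le_sub (gval R (o (npair 1 q))) w.
  by have := le_trans (nw q) (pow2_le1 q); lra.
(* The box B = 0 suffices, as the leading coefficient does not involve y. *)
have [|mu mu0 hmu] := @dpoly_box_bound n n 0.
  move=> t p q t01 _ _; rewrite dpoly_lead_indep.
  by rewrite addr_gt0 // cmod_gt0 lead.
have [k hk] := recip_small mu0.
pose P := (W + k).+1.
have [|nu nu0 hnu] := @dpoly_box_bound 0 1 (rbound n d P).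
  move=> t p q t01 _ _; set y := Complex p q.
  have [y0|yn] := eqVneq (dpoly n d 0 a (edge_path v w t) y) 0.
    by rewrite ltr_wpDl ?cmod_ge0 // cmod_gt0 simple.
  by rewrite ltr_pwDl ?cmod_ge0 // cmod_gt0.
have [D hD] := recip_small nu0.
exists P, D; set Q := mesh n d P D.
have WP : W%:R + 1 <= P%:R :> R.
  by rewrite natr1 ler_nat /P ltnS leq_addr.
have dt : data_test o n d P Q.
  apply/and3P; split; [|exact: cmod_gbounded (le_trans (Wv Q) WP)
                       |exact: cmod_gbounded (le_trans (Ww Q) WP)].
  apply/all_belowP => j _; apply/all_belowP => i _.
  exact: cmod_gbounded (le_trans (Wa Q j i) WP).
have cl := data_test_close dt.
have Q0 : (0 < Q)%N by exact: mesh_gt0.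
have grid01 i : (i < Q.+1)%N -> 0 <= (i%:R / Q%:R : R) <= 1.
  move=> iQ; rewrite divr_ge0 ?ler0n //= ler_pdivrMr ?ltr0n // mul1r ler_nat //.
have near0 (t : R) : `|t - t| <= Q%:R^-1 by rewrite subrr normr0 invr_ge0.
have near0' (y : C) : cmod (y - y) <= 2 * Q%:R^-1.
  by rewrite subrr cmod0 mulr_ge0 ?invr_ge0.
apply/and3P; split => //.
- apply/all_belowP => i iQ; apply: (@glarge_upper R).
  have i01 := grid01 i iQ.
  rewrite gval_dpoly_code gval_0 (gval_path_code _ _ (gval_gfrac_pred R i Q0)).
  have h0 : cmod (0 : C) <= (radius n d P)%:R by rewrite cmod0 ler0n.
  have := le_trans (dpoly_path_close n cl i01 i01 (near0 _) h0 h0 (near0' 0))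
    (err_le_P R P D).
  have := hmu _ 0 0 i01; rewrite normr0 => /(_ (lexx 0) (lexx 0)).
  have kP : P.+1%:R^-1 <= k.+1%:R^-1 :> R.
    by rewrite lef_pV2 ?posrE ?ltr0n // ler_nat !ltnS /P leqW // leq_addl.
  move: kP hk; move: (k.+1%:R^-1 : R) => r.
  move: (P.+1%:R^-1 : R) => e.
  rewrite -[(0 +i* 0)%C]/(0 : C).
  set u := dpoly n d n a _ _; set u' := dpoly _ _ _ _ _ _.
  have := cmod_le_sub u u'; rewrite (cmodBC u); lra.
apply/all_belowP => i iQ; apply/all_belowP => m mB; apply/all_belowP => l lB.
have i01 := grid01 i iQ.
have coord (c : nat) : (c < (2 * rbound n d P * Q).+1)%N ->
    `|c%:R / Q%:R - (rbound n d P)%:R : R| <= (rbound n d P)%:R.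
  rewrite ltnS -(ler_nat R) natrM natrM => cB.
  have c0 : 0 <= c%:R / Q%:R :> R by rewrite divr_ge0.
  have c1 : c%:R / Q%:R <= 2 * (rbound n d P)%:R :> R.
    by rewrite ler_pdivrMr ?ltr0n.
  by rewrite ler_norml; apply/andP; split; lra.
have hg : cmod (grid R n d P D m l) <= (radius n d P)%:R.
  apply: le_trans (cmod_le_re_im _ _) _; rewrite radiusE.
  by have := coord m mB; have := coord l lB; rewrite /Q; lra.
have := hnu _ _ _ i01 (coord m mB) (coord l lB); rewrite -/(grid R n d P D m l).
have c0 := le_trans (dpoly_path_close 0 cl i01 i01 (near0 _) hg hg (near0' _))
  (err_le_D R P D).
have c1 := le_trans (dpoly_path_close 1 cl i01 i01 (near0 _) hg hg (near0' _))
  (err_le_D R P D).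
(* The slack between 3 e and the error e / 2 covers the factor 2 of the test. *)
have half (x y e : R) : 6 * e <= nu -> nu <= x + y -> 3 * e <= x \/ 3 * e <= y.
  by move=> he hxy; have [|] := lerP (3 * e) x; [left | right; lra].
move=> /(half _ _ _ hD)[big|big].
- apply/orP; left; apply: (@glarge_upper R).
  rewrite gval_dpoly_code gval_grid_code
    (gval_path_code _ _ (gval_gfrac_pred R i Q0)).
  by apply: large_approx big c0; rewrite invr_ge0.
- apply/orP; right; apply: (@glarge_upper R).
  rewrite gval_dpoly_code gval_grid_code
    (gval_path_code _ _ (gval_gfrac_pred R i Q0)).
  by apply: large_approx big c1; rewrite invr_ge0.
Qed.

End Search.

Lemma rat_of_code_frac p b : rat_of_code (qfrac p b) = p%:R / b.+1%:R.
Proof. by rewrite /rat_of_code /qfrac /npair !Cantor.cancel_of_to subr0. Qed.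

Lemma nth_rat_mkseq u N m : (m < N)%N ->
  nth 0 (map rat_of_code (mkseq u N)) m = rat_of_code (u m).
Proof. by move=> mN; rewrite (nth_map 0%N) ?size_mkseq // nth_mkseq. Qed.

Lemma uniform_subdivision N : (0 < N)%N ->
  subdivision01 (map rat_of_code (mkseq (fun i => qfrac i N.-1) N.+1)).
Proof.
move=> N0; set ts := map _ _.
have sz : size ts = N.+1 by rewrite size_map size_mkseq.
have nthE m : (m < N.+1)%N -> nth 0 ts m = m%:R / N%:R.
  by move=> mN; rewrite nth_rat_mkseq // rat_of_code_frac prednK.
split.
- by rewrite /= rat_of_code_frac mul0r.
- rewrite -nth_last sz nthE //= divff // pnatr_eq0 -lt0n //.
- apply/(sortedP 0) => i; rewrite sz => iN.
  by rewrite !nthE // 1?ltnW // ltr_pM2r ?invr_gt0 ?ltr0n // ltr_nat.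
Qed.

Theorem lemma2p2 (R : realType) :
  exists prog : code,
  forall (K : divringClosed R[i]) (f : {poly {poly R[i]}}) (n : nat)
         (hex : 'I_6 -> R[i]) (v w : R[i]),
    finitely_generated K ->
    f \is a polyOver (polyOver K) ->
    size f = n.+1 ->
    absolutely_irreducible K f ->
    let S := critical_locus f in
    let c0 := barycenter S in
    let rho := 2 * max_distance S c0 in
    0 < rho ->
    regular_hexagon c0 rho hex ->
    voronoi_bounded_edge (S `|` range hex) v w ->
    (forall x0, edge_segment v w x0 ->
       exactly_n_simple_roots n (fiber f x0)) ->
  forall o : nat -> nat, names o (edge_data f v w) ->
  exists ts es : seq rat,
    [/\ outputs o prog (edge_degrees f) ts es,
        size ts = (size es).+1,
        subdivision01 ts
      & forall y : 'I_n -> R -> R[i], branches f v w y ->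
        forall m : nat, (m < size es)%N ->
        forall t : R, ratr (nth 0 ts m) <= t <= ratr (nth 0 ts m.+1) ->
        forall k k' : 'I_n,
          cmod (y k' t - y k (ratr (nth 0 ts m))) < ratr (nth 0 es m)
          <-> k' = k].
Proof.
have [prog Hprog] := isolation_program; exists prog.
move=> K f n hex v w _ _ sf _ S c0 rho _ _ _ simple o /names_data_name name.
pose d := (sizeY f).-1; pose a j i : R[i] := f`_j`_i.
have sY : (sizeY f <= d.+1)%N by exact: leqSpred.
have supp j i : ~~ ((j <= n)%N && (i <= d)%N) -> a j i = 0.
  rewrite negb_and -!ltnNge /a => /orP[nj|di].
    by rewrite (nth_default 0 (_ : size f <= j)%N) ?sf // coef0.
  by rewrite nth_default // (leq_trans (max_size_coefXY f j)) // (leq_trans sY).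
have onedge (t : R) : 0 <= t <= 1 -> edge_segment v w (edge_path v w t).
  by move=> t01; exists t; rewrite //= in_itv.
have fibE s x y : (fiber f x)^`(s).[y] = dpoly n d s a x y.
  exact: fiber_derivn.
have sfib x : (size (fiber f x) <= n.+1)%N.
  by rewrite /fiber /map_poly sf; exact: size_poly.
have rootE x y : root (fiber f x) y = (dpoly n d 0 a x y == 0).
  by rewrite -fibE derivn0.
have [P [D [tPD ev]]] : exists P D, test o n d P D /\
    Defs.eval o prog (npair n d)
      (subdivision_code (steps n d P D) (inv_eps n d P D)).
  apply: Hprog; apply: (test_complete name supp) => [t t01|t y t01 y0].
  - have := exactly_n_simple_roots_lead (simple _ (onedge t t01)) (sfib _).
    rewrite -fibE; have := sfib (edge_path v w t).
    move: (fiber f _) => p sp pn.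
    have -> : p^`(n).[0] = p`_n *+ n`!.
      by rewrite horner_coef0 coef_derivn addn0 ffactnn.
    by rewrite -mulr_natl mulf_neq0 // pnatr_eq0 -lt0n fact_gt0.
  - have := simple_root_deriv (simple _ (onedge t t01)) (_ : root _ y).
    by rewrite rootE y0 eqxx -fibE derivn1; apply.
set N := steps n d P D in ev; set E := inv_eps n d P D in ev.
have N0 : (0 < N)%N by exact: steps_gt0.
have E0 : (0 < E)%N by exact: inv_eps_gt0.
exists (map rat_of_code (mkseq (fun i => qfrac i N.-1) N.+1)),
  (map rat_of_code (mkseq (fun=> qfrac 1 E.-1) N)); split.
- exists (mkseq (fun i => qfrac i N.-1) N.+1), (mkseq (fun=> qfrac 1 E.-1) N).
  by split=> //; rewrite /edge_degrees sf.
- by rewrite !size_map !size_iota.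
- exact: uniform_subdivision.
have close := data_test_close name supp (proj1 (andP tPD)).
have cert := test_certified R tPD.
move=> y [cont yroot inj _] m; rewrite size_map size_mkseq => mN t.
rewrite !nth_rat_mkseq ?ltnS //; last exact: ltnW.
rewrite !ratr_rat_of_code !qval_frac !prednK // mul1r => tm k k'.
apply: (@branch_isolation R n (fun t z => root (fiber f (edge_path v w t)) z)
  y E%:R^-1 N%:R^-1 N) => //.
- by rewrite invr_gt0 ltr0n.
- move=> u z z' u01; rewrite !rootE => /eqP z0 /eqP z'0.
  exact: (certified_separation close cert u01).
- move=> u u' z z' u01 u'01 uu'; rewrite !rootE => /eqP z0 /eqP z'0.
  exact: (certified_annulus close cert u01 u'01 uu').
Qed.
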